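(* Let $T>0$, let $\varphi:\mathbb{R}\to\mathbb{R}$ be a homeomorphism with $\varphi(0)=0$, and let $f:[0,T]\times\mathbb{R}\times\mathbb{R}\to\mathbb{R}$ be continuous. Define $G:\mathbb{R}^{2}\to\mathbb{R}^{2}$ by \[ G(a,b)=\Big(aT+bT^{2}-bT-\frac1T\int_0^T f(t,a+bt,b)\,dt,\; b-a-bT\Big). \] Assume that $\Omega$ is an open bounded set in $C^{1}$ such that the following conditions hold. 1. For each $\lambda\in(0,1)$ the problem \[ (\varphi(u'))'=\lambda f(t,u,u'),\qquad u(T)=u'(0)=u'(T), \] has no solution on $\partial\Omega$. 2. The equation $G(a,b)=(0,0)$ has no solution on $\partial\Omega\cap\mathbb{R}^{2}$. 3. The Brouwer degree satisfies $\deg_{B}(G,\Omega\cap\mathbb{R}^{2},0)\neq 0$. Then the problem \[ (\varphi(u'))'=f(t,u,u'),\qquad u(T)=u'(0)=u'(T), \] has a solution.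
   Context: $C^{1}=C^{1}([0,T],\mathbb{R})$ is the Banach space of continuously differentiable functions with norm $\|u\|_{1}=\|u\|_{\infty}+\|u'\|_{\infty}$. The space $\mathbb{R}^{2}$ is identified with the subspace of affine functions in $C^{1}$ via $(a,b)\approx (t\mapsto a+bt)$; the sets $\Omega\cap\mathbb{R}^{2}$ and $\partial\Omega\cap\mathbb{R}^{2}$ are understood through this identification. For a continuous $g:[0,T]\times\mathbb{R}\times\mathbb{R}\to\mathbb{R}$, a solution of $(\varphi(u'))'=g(t,u,u')$, $u(T)=u'(0)=u'(T)$ is a function $u:[0,T]\to\mathbb{R}$ of class $C^{1}$ such that $\varphi(u')$ is continuously differentiable, $(\varphi(u'(t)))'=g(t,u(t),u'(t))$ for all $t\in[0,T]$, and $u(T)=u'(0)=u'(T)$. $\deg_B$ denotes the Brouwer degree. *)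

(* Defs.v *)
From HB Require Import structures.
From mathcomp Require Import all_boot all_order all_algebra ring lra.
From mathcomp Require Import all_classical all_reals all_analysis.

Set Implicit Arguments.
Unset Strict Implicit.
Unset Printing Implicit Defensive.

Import Order.TTheory GRing.Theory Num.Theory numFieldNormedType.Exports.

Local Open Scope classical_set_scope.
Local Open Scope ring_scope.

Definition frontier {X : topologicalType} (A : set X) : set X :=
  closure A `\` A°.

Definition homeomorphism {X Y : topologicalType} (f : X -> Y) : Prop :=
  exists g : Y -> X, [/\ continuous f, continuous g, cancel f g & cancel g f].

Section brouwer_degree.
Context {R : realType}.

Fixpoint Ck {n m : nat} (k : nat) (g : 'rV[R]_n -> 'rV[R]_m) : Prop :=
  if k is k'.+1 then
    (forall x, differentiable g x) /\ (forall v, Ck k' ('D_v g))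
  else continuous g.

Definition smooth {n m : nat} (g : 'rV[R]_n -> 'rV[R]_m) : Prop :=
  forall k, Ck k g.

Definition regular_value {n : nat} (g : 'rV[R]_n -> 'rV[R]_n)
    (U : set 'rV[R]_n) (y : 'rV[R]_n) : Prop :=
  forall x, U x -> g x = y -> \det ('J g x) != 0.

(* The sum has finitely many terms when [U] is bounded, [y] is a regular value
   and [y] has no preimage on the frontier of [U]. *)
Definition regular_degree {n : nat} (g : 'rV[R]_n -> 'rV[R]_n)
    (U : set 'rV[R]_n) (y : 'rV[R]_n) : int :=
  \sum_(x \in U `&` g @^-1` [set y]) sgz (\det ('J g x)).

(* [degree_spec f U y d] computes the degree d of [f] from a smooth map [g] with
   [y] as a regular value and sup_{closure U} |g - f| < dist(y, f(frontier U)):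
   as closure U is compact, this strict inequality is the existence of [e]. *)
Definition degree_spec {n : nat} (f : 'rV[R]_n -> 'rV[R]_n)
    (U : set 'rV[R]_n) (y : 'rV[R]_n) (d : int) : Prop :=
  exists g : 'rV[R]_n -> 'rV[R]_n,
    [/\ smooth g,
        exists2 e : R, (forall x, frontier U x -> e <= `|f x - y|)
                     & (forall x, closure U x -> `|g x - f x| < e),
        regular_value g U y
      & d = regular_degree g U y].

(* Classically, for [U] open and bounded, [f] continuous on closure U and [y] not
   in f(frontier U), exactly one integer satisfies [degree_spec f U y]. *)
Definition brouwer_degree {n : nat} (f : 'rV[R]_n -> 'rV[R]_n)
    (U : set 'rV[R]_n) (y : 'rV[R]_n) : int :=
  xget 0 (degree_spec f U y).

End brouwer_degree.

Definition seg {R : realType} (T : {posnum R}) : Type :=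
  set_type `[0, T%:num]%classic.
HB.instance Definition _ (R : realType) (T : {posnum R}) :=
  PseudoMetric.copy (seg T) (initial_topology (@set_val R `[0, T%:num]%classic)).

Section segment_calculus.
Context {R : realType} (T : {posnum R}).
Implicit Types (u v w : seg T -> R) (t s : seg T).

Fact seg0_subproof : 0 \in `[0, T%:num]%classic.
Proof. by rewrite inE/= in_itv/= lexx/=. Qed.
Definition seg0 : seg T := exist _ 0 seg0_subproof.

Fact segT_subproof : T%:num \in `[0, T%:num]%classic.
Proof. by rewrite inE/= in_itv/= lexx andbT. Qed.
Definition segT : seg T := exist _ T%:num segT_subproof.

Definition segval t : R := set_val t.

Lemma segval_inj : injective segval.
Proof. exact: val_inj. Qed.

Lemma segval_continuous : continuous segval.
Proof. exact: initial_continuous. Qed.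

Definition diffquot u t s : R := (u s - u t) / (segval s - segval t).

(* The limit is taken within [0,T]: it is one-sided at 0 and T. *)
Definition dseg u t : R := lim (diffquot u t @ t^').

Definition is_C1 u : Prop :=
  (forall t, cvg (diffquot u t @ t^')) /\ continuous (dseg u).

Definition supnorm w : R := sup (range (fun t => `|w t|)).

Lemma seg_near (x e : R) : 0 <= x -> x <= T%:num -> 0 < e ->
  exists s : R, [/\ 0 <= s, s <= T%:num, s != x & `|x - s| < e].
Proof.
move=> x0 xT e0; have T0 : 0 < T%:num :> R by [].
have [xT'|Tx] := ltP x T%:num.
  exists (Num.min (x + e / 2) T%:num).
  have h : x < Num.min (x + e / 2) T%:num.
    by rewrite lt_min xT' andbT; lra.
  have h1 : Num.min (x + e / 2) T%:num <= x + e / 2 by rewrite ge_min lexx.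
  have h2 : Num.min (x + e / 2) T%:num <= T%:num by rewrite ge_min lexx orbT.
  split => //; [by lra|by rewrite gt_eqF|].
  by rewrite ltr_norml; apply/andP; split; lra.
exists (Num.max (x - e / 2) 0).
have h : Num.max (x - e / 2) 0 < x by rewrite gt_max; apply/andP; split; lra.
have h1 : x - e / 2 <= Num.max (x - e / 2) 0 by rewrite le_max lexx.
have h2 : 0 <= Num.max (x - e / 2) 0 by rewrite le_max lexx orbT.
split => //; [by lra|by rewrite lt_eqF|].
by rewrite ltr_norml; apply/andP; split; lra.
Qed.

#[global] Instance seg_dnbhs_proper t : ProperFilter t^'.
Proof.
apply: Build_ProperFilter_ex => A.
rewrite /dnbhs /within/= => /nbhs_ballP[e /= e0 eA].
have /set_mem /= := valP t; rewrite in_itv/= => /andP[t0 tT].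
have [s [s0 sT st se]] := seg_near t0 tT e0.
have sP : s \in `[0, T%:num]%classic by rewrite inE/= in_itv/= s0.
by exists (exist _ s sP); apply: (eA (exist _ s sP)).
Qed.

Lemma dseg_eq u t l : diffquot u t @ t^' --> l -> dseg u t = l.
Proof. by move=> ul; exact/cvg_lim. Qed.

Lemma diffquotD u v t : diffquot (u + v) t = diffquot u t \+ diffquot v t.
Proof. by apply/funext => s; rewrite /diffquot/= -mulrDl addrACA opprD. Qed.

Lemma diffquotZ (a : R) u t : diffquot (a *: u) t = (fun s => a * diffquot u t s).
Proof. by apply/funext => s; rewrite /diffquot/= mulrA mulrBr. Qed.

Lemma dsegD u v : is_C1 u -> is_C1 v -> dseg (u + v) = dseg u \+ dseg v.
Proof.
move=> [du _] [dv _]; apply/funext => t; apply: dseg_eq.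
by rewrite diffquotD; apply: cvgD; [exact: du|exact: dv].
Qed.

Lemma dsegZ (a : R) u : is_C1 u -> dseg (a *: u) = (fun t => a * dseg u t).
Proof.
move=> [du _]; apply/funext => t; apply: dseg_eq.
by rewrite diffquotZ; apply: cvgMl_tmp; exact: du.
Qed.

Lemma is_C1_affine (a b : R) : is_C1 (fun t => a + b * segval t).
Proof.
have h t : diffquot (fun t => a + b * segval t) t @ t^' --> b.
  apply: cvg_near_cst; near=> s.
  have st : segval s - segval t != 0.
    rewrite subr_eq0 (inj_eq segval_inj).
    by near: s; exact: nbhs_dnbhs_neq.
  by rewrite /diffquot opprD addrACA subrr add0r -mulrBr mulfK.
split => [t|]; first by apply/cvg_ex; exists b; exact: h.
rewrite (_ : dseg _ = cst b); first exact: cst_continuous.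
by apply/funext => t; exact: dseg_eq.
Unshelve. all: by end_near. Qed.

Definition C1pred : {pred seg T -> R} := fun u => `[< is_C1 u >].

Lemma C1pred_submod_closed : submod_closed C1pred.
Proof.
split=> [|a u v /asboolP cu /asboolP cv]; apply/asboolP.
  rewrite (_ : 0 = fun t => 0 + 0 * segval t); first exact: is_C1_affine.
  by apply/funext => t; rewrite mul0r addr0.
have cau : is_C1 (a *: u).
  case: (cu) => du ku; split => [t|].
    by rewrite diffquotZ; apply: is_cvgMl_tmp; exact: du.
  by rewrite dsegZ// => t; exact: cvgMl_tmp (ku t).
case: (cau) (cv) => dau kau [dv kv]; split => [t|].
  by rewrite diffquotD; apply: is_cvgD; [exact: dau|exact: dv].
by rewrite dsegD// => t; exact: cvgD (kau t) (kv t).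
Qed.

Lemma is_C1_continuous u : is_C1 u -> continuous u.
Proof.
move=> [du _] t.
have hv : segval @ t^' --> segval t.
  exact: cvg_trans (cvg_fmap2 (@nbhs_dnbhs _ t)) (@segval_continuous t).
have h1 : diffquot u t s * (segval s - segval t) + u t @[s --> t^'] -->
    dseg u t * (segval t - segval t) + u t.
  apply: cvgD; last exact: cvg_cst.
  by apply: cvgM; [exact: du|apply: cvgB => //; exact: cvg_cst].
have h2 : u @ t^' --> u t.
  move: h1; rewrite subrr mulr0 add0r.
  apply: cvg_trans; apply: near_eq_cvg; near=> s.
  rewrite /= /diffquot mulfVK ?subrK// subr_eq0 (inj_eq segval_inj).
  by near: s; exact: nbhs_dnbhs_neq.
rewrite /continuous_at dnbhsE => A uA; split; first exact: h2.
by apply/principal_filterP; exact: nbhs_singleton uA.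
Unshelve. all: by end_near. Qed.

Lemma continuous_bounded w : continuous w -> exists M, forall t, `|w t| <= M.
Proof.
move=> /(@subspace_valL_continuousP' R `[0, T%:num]%classic R 0 w).
move=> /continuous_compact/(_ (@segment_compact _ _ _))/compact_bounded.
move=> [M [_ hM]]; exists (M + 1) => t.
apply: (hM (M + 1)); [by rewrite ltrDl|exists (segval t)].
  exact/set_mem/(valP t).
by have /(congr1 (@^~ t)) := valLK 0 w.
Qed.

Lemma supnorm_ub w t : continuous w -> `|w t| <= supnorm w.
Proof.
move=> /continuous_bounded[M hM]; apply: ub_le_sup; last by exists t.
by exists M => _ [s _ <-].
Qed.

Lemma supnorm_le w (M : R) : (forall t, `|w t| <= M) -> supnorm w <= M.
Proof.
move=> hM; apply: ge_sup; first by exists `|w seg0|, seg0.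
by move=> _ [t _ <-].
Qed.

Lemma supnormD v w : continuous v -> continuous w ->
  supnorm (v \+ w) <= supnorm v + supnorm w.
Proof.
move=> cv cw; apply: supnorm_le => t; apply: (le_trans (ler_normD _ _)).
by apply: lerD; exact: supnorm_ub.
Qed.

Lemma supnormZ (a : R) w : continuous w ->
  supnorm (fun t => a * w t) = `|a| * supnorm w.
Proof.
move=> cw; have caw : continuous (fun t => a * w t).
  by move=> t; exact: cvgMl_tmp (cw t).
apply/eqP; rewrite eq_le; apply/andP; split.
  by apply: supnorm_le => t; rewrite normrM ler_wpM2l// supnorm_ub.
have [a0|a0] := eqVneq a 0.
  apply: le_trans (supnorm_ub seg0 caw).
  by rewrite {1}a0 normr0 mul0r.
rewrite -ler_pdivlMl ?normr_gt0//; apply: supnorm_le => t.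
by rewrite ler_pdivlMl ?normr_gt0// -normrM; exact: (supnorm_ub t caw).
Qed.

Lemma supnorm_ge0 w : continuous w -> 0 <= supnorm w.
Proof. by move=> cw; exact: le_trans (supnorm_ub seg0 cw). Qed.

End segment_calculus.

Record C1 (R : realType) (T : {posnum R}) := MkC1 {
  C1val :> seg T -> R;
  _ : C1val \in @C1pred R T
}.

Section C1_normedModType.
Context {R : realType} (T : {posnum R}).

HB.instance Definition _ := [isSub for @C1val R T].
HB.instance Definition _ := [Choice of C1 T by <:].
HB.instance Definition _ := GRing.isSubmodClosed.Build R (seg T -> R)
  (@C1pred R T) (@C1pred_submod_closed R T).
HB.instance Definition _ := [SubChoice_isSubLmodule of C1 T by <:].

Lemma C1P (u : C1 T) : is_C1 u.
Proof. by apply/asboolP; case: u. Qed.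

Definition C1norm (u : C1 T) : R := supnorm u + supnorm (dseg u).

Let cu (u : C1 T) : continuous u. Proof. exact/is_C1_continuous/C1P. Qed.
Let cdu (u : C1 T) : continuous (dseg u). Proof. by have [] := C1P u. Qed.

Lemma C1normD u v : C1norm (u + v) <= C1norm u + C1norm v.
Proof.
rewrite /C1norm addrACA lerD//; first exact: (supnormD (@cu u) (@cu v)).
by rewrite [dseg _](dsegD (C1P u) (C1P v)); exact: (supnormD (@cdu u) (@cdu v)).
Qed.

Lemma C1normZ (a : R) u : C1norm (a *: u) = `|a| * C1norm u.
Proof.
rewrite /C1norm mulrDr; congr (_ + _); first exact: (supnormZ a (@cu u)).
by rewrite [dseg _](dsegZ a (C1P u)) (supnormZ a (@cdu u)).
Qed.

Lemma C1norm0_eq0 u : C1norm u = 0 -> u = 0.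
Proof.
move=> u0; apply/val_inj/funext => t; apply/eqP; rewrite -normr_le0.
rewrite -u0; apply: (le_trans (supnorm_ub t (@cu u))).
by rewrite lerDl supnorm_ge0.
Qed.

HB.instance Definition _ :=
  Lmodule_isNormed.Build R (C1 T) C1normD C1normZ C1norm0_eq0.

Lemma C1_normE (u : C1 T) : `|u| = supnorm u + supnorm (dseg u).
Proof. by []. Qed.

(* The identification of R^2 with the affine functions, (a, b) |-> a + b t *)
Definition affineC1 (v : 'rV[R]_2) : C1 T :=
  MkC1 (asboolT (is_C1_affine T (v 0 0) (v 0 1))).

End C1_normedModType.

Section problem.
Context {R : realType} (T : {posnum R}).

(* A nonlinearity on [0,T] x R x R is given as a total function on R * R * R;
   only its values at points (t, x, y) with t in [0,T] are ever used. *)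
Definition strip : set (R * R * R) := [set p | 0 <= p.1.1 <= T%:num].

Definition is_solution (phi : R -> R) (g : R * R * R -> R) (u : C1 T) : Prop :=
  [/\ is_C1 (phi \o dseg u),
      forall t : seg T, dseg (phi \o dseg u) t = g (segval t, u t, dseg u t),
      u (segT T) = dseg u (seg0 T)
    & dseg u (seg0 T) = dseg u (segT T)].

Definition Gmap (f : R * R * R -> R) (v : 'rV[R]_2) : 'rV[R]_2 :=
  let a := v 0 0 in let b := v 0 1 in let l := T%:num in
  \row_(j < 2)
    if j == 0 then
      a * l + b * l ^+ 2 - b * l
      - l^-1 * \int[lebesgue_measure]_(t in `[0, l]) f (t, a + b * t, b)
    else b - a - b * l.

End problem.

(* Main.v *)
Require Import Defs.
From mathcomp Require Import all_boot all_order all_algebra ring lra zify.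
From mathcomp Require Import all_classical all_reals all_analysis.

Import Order.TTheory GRing.Theory Num.Theory numFieldNormedType.Exports.

Set Implicit Arguments.
Unset Strict Implicit.
Unset Printing Implicit Defensive.

Local Open Scope classical_set_scope.
Local Open Scope ring_scope.

(* Replacing phi(u') by Euler polygons turns the boundary value problem into a
   planar one: for each mesh, the polygon u_N(lam, a, b) starting from u(0) = a,
   u'(0) = b depends continuously on (lam, a, b), and it is the affine function
   a + b t when lam = 0. Let Gseg(u) be the formula of G with the affine function
   replaced by u. If there were no solution, then, for a fine mesh, no zero of
   Gseg o u_N with lam in [0, 1] would have u_N on the frontier of Omega, and none
   with lam = 1 would have u_N in Omega: otherwise, by Ascoli's argument along an
   ultrafilter, a limit u of such polygons would satisfy
   (phi(u'))' = lam f(t, u, u'), u(T) = u'(0) and int f(t, u, u') = 0, hence also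
   u'(0) = u'(T) since phi is injective, which the hypotheses forbid.
   So Gseg o u_N is a homotopy, on a bounded domain varying with lam, from G to a
   map without zeros, and the degree of G vanishes.

   The planar degree is computed combinatorially: a map is labelled at the points
   of a fine grid by the one of three sectors of the plane containing its value,
   and the total turning of the labels around the grid squares is counted. Cells
   where the map stays away from 0 miss a sector and contribute nothing, and
   turning is conserved through the faces of a cube, whence homotopy invariance. *)

(** * Turning of sector labels on a planar grid *)

(* The signed step between two labels in the cyclic order
   None, Some false, Some true of the sectors *)
Definition turn (a b : option bool) : int :=
  match a, b with
  | None, Some false | Some false, Some true | Some true, None => 1
  | Some false, None | Some true, Some false | None, Some true => -1
  | _, _ => 0
  end.

Lemma turnC a b : turn b a = - turn a b.
Proof. by case: a => [[]|]; case: b => [[]|]. Qed.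

(** Each step is congruent modulo 3 to the difference of its labels in the cyclic order, so the sum
    around a square is a multiple of 3: three times the number of turns made by the labels. *)
Definition curl a b c d : int := turn a b + turn b c + turn c d + turn d a.

(** With one label excluded, [turn] is the difference of a height function on the two remaining
    labels, and differences cancel along a closed path. *)
Lemma curl_missing l a b c d :
  a != l -> b != l -> c != l -> d != l -> curl a b c d = 0.
Proof.
by case: l => [[]|]; case: a => [[]|] //; case: b => [[]|] //;
  case: c => [[]|] //; case: d => [[]|].
Qed.

(** Every edge of the cube is traversed by exactly two faces, in opposite directions, and [turn] is
    antisymmetric. *)
Lemma curl_cube a b c d a' b' c' d' :
  (curl a' b' c' d' - curl a b c d) + (curl b c c' b' - curl a d d' a')
  + (curl d d' c' c - curl a a' b' b) = 0.
Proof.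
have := (turnC a b, turnC b c, turnC c d, turnC d a).
move: (turnC a a') (turnC b b') (turnC c c') (turnC d d').
move: (turnC a' b') (turnC b' c') (turnC c' d') (turnC d' a') => ? ? ? ? ? ? ? ?.
by case=> [[[? ?] ?] ?]; rewrite /curl; lia.
Qed.

Section winding.
Context {R : realType}.
Implicit Types (h : 'rV[R]_2 -> 'rV[R]_2) (chi : 'rV[R]_2 -> int).

(* The three sectors cover the plane and only the origin is close to all three. *)
Definition sector (v : 'rV[R]_2) : option bool :=
  if v 0 1 < 0 then None else Some (v 0 0 < 0).

Definition vec (x y : R) : 'rV[R]_2 := \row_j (if j == 0 then x else y).

(** Indices from 0 to [2 * M * n.+1] sweep the square of half-side [M] with mesh [1 / n.+1]; the
    origin is the node whose two indices are [M * n.+1]. *)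
Definition lattice (M n i j : nat) : 'rV[R]_2 :=
  vec (i%:R / n.+1%:R - M%:R) (j%:R / n.+1%:R - M%:R).

Definition cell (M n : nat) h i j : int :=
  curl (sector (h (lattice M n i j))) (sector (h (lattice M n i.+1 j)))
       (sector (h (lattice M n i.+1 j.+1))) (sector (h (lattice M n i j.+1))).

(* Three times the degree of [h] with respect to 0 when [chi] is the indicator of
   an open set and [n] is large; [M] bounds the domain. *)
Definition winding (M n : nat) h chi : int :=
  \sum_(i < 2 * M * n.+1) \sum_(j < 2 * M * n.+1)
    chi (lattice M n i j) * cell M n h i j.

Lemma ord2 (j : 'I_2) : j = 0 \/ j = 1.
Proof. by case: j => [[|[|//]] jP]; [left|right]; apply/val_inj. Qed.

Lemma vec0 x y : vec x y 0 0 = x. Proof. by rewrite mxE. Qed.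
Lemma vec1 x y : vec x y 0 1 = y. Proof. by rewrite mxE. Qed.
Lemma vecE (v : 'rV[R]_2) : v = vec (v 0 0) (v 0 1).
Proof.
by apply/rowP => j; rewrite mxE; have [->|->] := ord2 j.
Qed.

Lemma norm_rV2_le (v : 'rV[R]_2) (e : R) :
  (`|v| <= e) = (`|v 0 0| <= e) && (`|v 0 1| <= e).
Proof.
rewrite /Num.norm/= mx_normrE; apply/idP/andP => [ve|[v0 v1]].
  split; apply: le_trans ve; apply/bigmax_geP; right; first by exists (0, 0).
  by exists (0, 1).
apply: bigmax_le => [|[i j] _ /=]; first exact: le_trans (normr_ge0 _) v0.
by rewrite (ord1 i); have [->|->] := ord2 j.
Qed.

Lemma norm_rV2_lt (v : 'rV[R]_2) (e : R) :
  (`|v| < e) = (`|v 0 0| < e) && (`|v 0 1| < e).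
Proof.
have := norm_rV2_le v `|v|; rewrite lexx => /esym/andP[v0 v1].
apply/idP/andP => [ve|[v0e v1e]]; first by split; exact: le_lt_trans ve.
have : `|v| <= Num.max `|v 0 0| `|v 0 1| by rewrite norm_rV2_le !le_max !lexx orbT.
move=> /le_lt_trans; apply.
by rewrite gt_max v0e.
Qed.

Lemma coord_cvg {T : topologicalType} (h : T -> 'rV[R]_2) (z : T) j :
  {for z, continuous h} -> h x 0 j @[x --> z] --> h z 0 j.
Proof.
move=> hz.
exact: (@cvg_comp _ _ _ h (fun M : 'rV[R]_2 => M 0 j) _ _ _ hz
  (@coord_continuous R 1 2 0 j (h z))).
Qed.

(** A strict sign of one coordinate persists nearby and excludes a sector. The second coordinate is
    tried first; where it vanishes, the first one does not, and its sign tells which of the two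
    upper sectors is excluded. *)
Lemma sector_near {T : topologicalType} (h : T -> 'rV[R]_2) z :
  h z != 0 -> {for z, continuous h} ->
  exists l, \forall x \near z, sector (h x) != l.
Proof.
move=> hz0 hz.
have c0 := coord_cvg (j := 0) hz; have c1 := coord_cvg (j := 1) hz.
have [h1|h1|h1] := ltgtP (h z 0 1) 0.
- exists (Some true); near=> x; rewrite /sector ifT//.
  by near: x; apply: cvgr_lt c1 _ h1.
- exists None; near=> x; rewrite /sector ifF//; apply/negbTE; rewrite -leNgt ltW//.
  by near: x; apply: cvgr_gt c1 _ h1.
have [h0|h0|h0] := ltgtP (h z 0 0) 0.
- exists (Some false); near=> x; rewrite /sector; case: ifP => // _.
  by rewrite (_ : h x 0 0 < 0)//; near: x; apply: cvgr_lt c0 _ h0.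
- exists (Some true); near=> x; rewrite /sector; case: ifP => // _.
  rewrite (_ : h x 0 0 < 0 = false)//; apply/negbTE; rewrite -leNgt ltW//.
  by near: x; apply: cvgr_gt c0 _ h0.
- by move: hz0; rewrite [h z]vecE h0 h1 (_ : vec 0 0 = 0) ?eqxx//;
    apply/rowP => j; rewrite !mxE if_same.
Unshelve. all: by end_near. Qed.

End winding.

(** Compactness in its near-covering form, with the radius as a parameter tending to 0. Since [good]
    only has to pass to subsets, it may be an alternative between two properties or a bound on an
    oscillation. *)
Lemma lebesgue_number {R : realType} {X : pseudoMetricType R} (K : set X)
    (good : set X -> Prop) :
  compact K -> (forall A B, A `<=` B -> good B -> good A) ->
  (forall z, K z -> exists2 V, nbhs z V & good V) ->
  exists2 e : R, 0 < e & forall x, K x -> good (ball x e).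
Proof.
move=> /compact_near_coveringP cK goodS goodK.
have [z Kz|/= e /= e0 eK] := cK R (0^'+) (fun e x => good (ball x e)) _.
  have [V /nbhs_ballP[r /= r0 rV] gV] := goodK z Kz.
  exists (ball z (r / 2), [set e | e < r / 2]) => /=.
    split; first by apply: nbhsx_ballx; rewrite divr_gt0.
    by apply: nbhs_right_lt; rewrite divr_gt0.
  move=> [x e] /= [zx er]; apply: goodS gV => y xy; apply: rV.
  by rewrite [r]splitr; apply: ball_triangle zx _; exact: le_ball (ltW er) _ xy.
exists (e / 2); first by rewrite divr_gt0.
apply: eK; last by rewrite divr_gt0.
by rewrite /= sub0r normrN gtr0_norm ?divr_gt0//; lra.
Qed.

(** * Homotopy invariance *)

Lemma telescope_ord (N : nat) (F : nat -> int) :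
  \sum_(i < N) (F i.+1 - F i) = F N - F 0%N.
Proof. by rewrite -(big_mkord xpredT (fun i => F i.+1 - F i)) telescope_sumr. Qed.

(** A discrete divergence theorem: the change from [Z] to [Z'] is compensated by the divergence of
    the flux [(X, Y)], whose sum telescopes to values on the border of the grid, where the flux
    vanishes. *)
Lemma grid_conservation (N : nat) (Z Z' X Y : nat -> nat -> int) :
  (forall i j, (i < N)%N -> (j < N)%N ->
    Z' i j - Z i j + (X i.+1 j - X i j) + (Y i j.+1 - Y i j) = 0) ->
  (forall j, X 0%N j = 0) -> (forall j, X N j = 0) ->
  (forall i, Y i 0%N = 0) -> (forall i, Y i N = 0) ->
  \sum_(i < N) \sum_(j < N) Z' i j = \sum_(i < N) \sum_(j < N) Z i j.
Proof.
move=> ZXY X0 XN Y0 YN.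
have sX : \sum_(i < N) \sum_(j < N) (X i.+1 j - X i j) = 0.
  rewrite exchange_big big1// => j _.
  by rewrite (telescope_ord N (X ^~ j)) X0 XN subrr.
have sY : \sum_(i < N) \sum_(j < N) (Y i j.+1 - Y i j) = 0.
  by rewrite big1// => i _; rewrite (telescope_ord N (Y i)) Y0 YN subrr.
suff : \sum_(i < N) \sum_(j < N) Z' i j - \sum_(i < N) \sum_(j < N) Z i j
    + \sum_(i < N) \sum_(j < N) (X i.+1 j - X i j)
    + \sum_(i < N) \sum_(j < N) (Y i j.+1 - Y i j) = 0.
  by rewrite sX sY !addr0 => /subr0_eq.
rewrite -sumrB -2!big_split/= big1// => i _.
rewrite -sumrB -2!big_split/= big1// => j _.
exact: ZXY.
Qed.

Section winding.
Context {R : realType}.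

Lemma lattice_step (M n i j i' j' : nat) (e : R) : n.+1%:R^-1 < e ->
  (i <= i' <= i.+1)%N -> (j <= j' <= j.+1)%N ->
  ball (lattice M n i j : 'rV[R]_2) e (lattice M n i' j').
Proof.
move=> ne ii jj.
have aux k k' : (k <= k' <= k.+1)%N -> `|k%:R / n.+1%:R - M%:R - (k'%:R / n.+1%:R - M%:R)| < e :> R.
  move=> kk; apply: le_lt_trans ne.
  rewrite opprB addrA subrK -mulrBl normrM normfV [`|n.+1%:R|]ger0_norm//.
  rewrite ler_piMl ?invr_ge0//.
  have [->|->] : k' = k \/ k' = k.+1 by lia.
    by rewrite subrr normr0.
  by rewrite -natr1 opprD addrA subrr sub0r normrN normr1.
by rewrite -ball_normE /ball_/= norm_rV2_lt !mxE/= !aux.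
Qed.

Lemma lattice_bound (M n i j : nat) : (i <= 2 * M * n.+1)%N -> (j <= 2 * M * n.+1)%N ->
  `|lattice M n i j : 'rV[R]_2| <= M%:R.
Proof.
move=> iM jM; have aux k : (k <= 2 * M * n.+1)%N -> `|k%:R / n.+1%:R - M%:R| <= M%:R :> R.
  move=> kM; rewrite ler_norml lerBrDr addNr divr_ge0//= lerBlDr ler_pdivrMr//.
  by rewrite -natrD -natrM ler_nat; lia.
by rewrite norm_rV2_le !mxE/= !aux.
Qed.

Lemma lattice_edge (M n i j : nat) :
  (i == 0) || (i == 2 * M * n.+1)%N || (j == 0) || (j == 2 * M * n.+1)%N ->
  M%:R <= `|lattice M n i j : 'rV[R]_2|.
Proof.
have aux k : (k == 0) || (k == 2 * M * n.+1)%N -> M%:R <= `|k%:R / n.+1%:R - M%:R| :> R.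
  move=> /orP[/eqP->|/eqP->]; first by rewrite mul0r sub0r normrN ger0_norm.
  by rewrite natrM mulfK// natrM -[X in _ - X]mul1r -mulrBl (_ : 2%:R - 1 = 1)
    ?mul1r ?ger0_norm//; lra.
have := norm_rV2_le (lattice M n i j) `|lattice M n i j : 'rV[R]_2|.
rewrite lexx !mxE/= => /esym/andP[h0 h1].
rewrite -orbA -orbA orbA => /orP[/aux/le_trans|/aux/le_trans]; exact.
Qed.

Lemma compact_box (M : R) : compact [set x : 'rV[R]_2 | `|x| <= M].
Proof.
apply: bounded_closed_compact.
  by exists M; split => [|r Mr x /= xM]; [exact: num_real|exact/ltW/(le_lt_trans xM)].
rewrite (_ : [set _ | _] = closed_ball_ Num.norm 0 M); first exact: closed_closed_ball_.
by apply/seteqP; split => x; rewrite /closed_ball_/= sub0r normrN.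
Qed.

Definition locally_cst {T : topologicalType} (chi : T -> int) (z : T) :=
  \forall z' \near z, chi z' = chi z.

(** Time is cut with the same mesh as the plane, and the weighted turnings of the faces of each
    small cube balance. The weight depends on time as well, so the domain may move, as long as zeros
    of [H] occur only where the weight is locally constant. *)
Lemma winding_homotopy (M : nat) (H : R * 'rV[R]_2 -> 'rV[R]_2)
    (chi : R * 'rV[R]_2 -> int) :
  (forall (t : R) (x : 'rV[R]_2), 0 <= t <= 1 -> `|x| <= M%:R ->
    H (t, x) != 0 /\ {for (t, x), continuous H} \/ locally_cst chi (t, x)) ->
  (forall (t : R) (x : 'rV[R]_2), 0 <= t <= 1 -> M%:R <= `|x| -> chi (t, x) = 0) ->
  \forall n \near \oo, winding M n (fun x => H (0, x)) (fun x => chi (0, x)) =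
                       winding M n (fun x => H (1, x)) (fun x => chi (1, x)).
Proof.
move=> H0 chi0.
(* On a small cell either the labels miss a sector, so that its faces do not turn,
   or the weight is constant. *)
pose good (V : set (R * 'rV[R]_2)) := (exists l : option bool, forall z, V z -> sector (H z) != l) \/
  (exists c, forall z, V z -> chi z = c).
have [|||e e0 eK] := @lebesgue_number R (R * 'rV[R]_2)%type
  ([set` `[0 : R, 1]] `*` [set x : 'rV[R]_2 | `|x| <= M%:R]) good.
- by apply: compact_setX; [exact: segment_compact|exact: compact_box].
- by move=> A B AB [[l hl]|[c hc]]; [left; exists l|right; exists c];
    move=> z /AB; [exact: hl|exact: hc].
- move=> [t x] [/=]; rewrite in_itv/= => t01 xM.
  have [[h0 hc]|ch] := H0 t x t01 xM.
    have [l hl] := sector_near h0 hc.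
    by exists [set z | sector (H z) != l] => //; left; exists l.
  by exists [set z | chi z = chi (t, x)] => //; right; exists (chi (t, x)).
near=> n.
have ne : n.+1%:R^-1 < e.
  near: n; apply: (near_infty_natSinv_lt (PosNum e0)).
have step k : (k < n.+1)%N ->
  winding M n (fun x => H (k.+1%:R / n.+1%:R, x)) (fun x => chi (k.+1%:R / n.+1%:R, x)) =
  winding M n (fun x => H (k%:R / n.+1%:R, x)) (fun x => chi (k%:R / n.+1%:R, x)).
  move=> kn.
  have t01 k' : (k' <= n.+1)%N -> 0 <= (k'%:R / n.+1%:R : R) <= 1.
    by move=> k'n; rewrite divr_ge0//= ler_pdivrMr// mul1r ler_nat.
  pose s k i j := sector (H (k%:R / n.+1%:R, lattice M n i j)).
  pose w k i j := chi (k%:R / n.+1%:R, lattice M n i j).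
  (* The bottom and top faces of the cubes give [Z] and [Z'], their lateral faces give the fluxes.
     The latter vanish on the border because [chi] does. *)
  apply: (@grid_conservation (2 * M * n.+1)
    (fun i j => w k i j * curl (s k i j) (s k i.+1 j) (s k i.+1 j.+1) (s k i j.+1))
    (fun i j => w k.+1 i j * curl (s k.+1 i j) (s k.+1 i.+1 j) (s k.+1 i.+1 j.+1) (s k.+1 i j.+1))
    (fun i j => w k i j * curl (s k i j) (s k i j.+1) (s k.+1 i j.+1) (s k.+1 i j))
    (fun i j => w k i j * curl (s k i j) (s k.+1 i j) (s k.+1 i.+1 j) (s k i.+1 j))).
  - move=> i j iN jN.
    have := eK (k%:R / n.+1%:R, lattice M n i j) _.
    have vK k' i' j' : (k <= k' <= k.+1)%N -> (i <= i' <= i.+1)%N -> (j <= j' <= j.+1)%N ->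
        ball ((k%:R / n.+1%:R : R), (lattice M n i j : 'rV[R]_2)) e (k'%:R / n.+1%:R, lattice M n i' j').
      move=> kk ii jj; split; last exact: lattice_step.
      (* For [M = 0] the coordinates of a node are plain multiples of the mesh, so the estimate for
         grid steps also covers the time step. *)
      have := lattice_step 0 ne kk kk; rewrite -ball_normE /ball_/= norm_rV2_lt !mxE/= !subr0.
      by move=> /andP[].
    move=> [|[l hl]|[c hc]].
    + by split; [rewrite /= in_itv/= t01// ltnW|apply: lattice_bound; lia].
    + have hs k' i' j' : (k <= k' <= k.+1)%N -> (i <= i' <= i.+1)%N -> (j <= j' <= j.+1)%N ->
        s k' i' j' != l by move=> ? ? ?; apply: hl; exact: vK.
      by rewrite /cell -/(s _ _ _) !(curl_missing (l := l)) ?mulr0 ?subrr ?addr0//; apply: hs; lia.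
    + have hw k' i' j' : (k <= k' <= k.+1)%N -> (i <= i' <= i.+1)%N -> (j <= j' <= j.+1)%N ->
        w k' i' j' = c by move=> ? ? ?; apply: hc; exact: vK.
      rewrite -!/(w _ _ _) !hw ?leqnn ?leqnSn// -!mulrBr -!mulrDr.
      by rewrite /cell -!/(s _ _ _) curl_cube mulr0.
  - by move=> j; rewrite /w chi0 ?mul0r// ?t01 1?ltnW// lattice_edge.
  - by move=> j; rewrite /w chi0 ?mul0r// ?t01 1?ltnW// lattice_edge// eqxx !orbT.
  - by move=> j; rewrite /w chi0 ?mul0r// ?t01 1?ltnW// lattice_edge// eqxx !orbT.
  - by move=> j; rewrite /w chi0 ?mul0r// ?t01 1?ltnW// lattice_edge// eqxx !orbT.
have main k : (k <= n.+1)%N ->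
  winding M n (fun x => H (k%:R / n.+1%:R, x)) (fun x => chi (k%:R / n.+1%:R, x)) =
  winding M n (fun x => H (0, x)) (fun x => chi (0, x)).
  by elim: k => [|k IH] kn; [rewrite mul0r|rewrite step// IH// ltnW].
by rewrite -(main n.+1)// divff.
Unshelve. all: by end_near. Qed.

(** On a fine grid each square either misses a sector, and does not turn, or has weight 0. *)
Lemma winding_vanish (M : nat) (h : 'rV[R]_2 -> 'rV[R]_2) (chi : 'rV[R]_2 -> int) :
  (forall x : 'rV[R]_2, `|x| <= M%:R ->
    h x != 0 /\ {for x, continuous h} \/ \forall y \near x, chi y = 0) ->
  \forall n \near \oo, winding M n h chi = 0.
Proof.
move=> H0.
pose good (V : set ('rV[R]_2)) := (exists l : option bool, forall z, V z -> sector (h z) != l) \/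
  (forall z, V z -> chi z = 0).
have [|||e e0 eK] := @lebesgue_number R 'rV[R]_2 [set x : 'rV[R]_2 | `|x| <= M%:R] good.
- exact: compact_box.
- by move=> A B AB [[l hl]|hc]; [left; exists l|right];
    move=> z /AB; [exact: hl|exact: hc].
- move=> x /= xM; have [[h0 hc]|ch] := H0 x xM.
    have [l hl] := sector_near h0 hc.
    by exists [set z | sector (h z) != l] => //; left; exists l.
  by exists [set z | chi z = 0] => //; right.
near=> n.
have ne : n.+1%:R^-1 < e.
  near: n; apply: (near_infty_natSinv_lt (PosNum e0)).
apply: big1 => i _; apply: big1 => j _.
have [|[l hl]|hc] := eK (lattice M n i j) _.
- by apply: lattice_bound; rewrite ltnW.
- rewrite /cell (curl_missing (l := l)) ?mulr0//; apply: hl; apply: lattice_step => //; lia.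
- by rewrite hc ?mul0r//; apply: ballxx.
Unshelve. all: by end_near. Qed.

End winding.

(** * Linear maps *)

Lemma sum_supp1 (N a b : nat) (F : nat -> nat -> int) : (a < N)%N -> (b < N)%N ->
  (forall i j, (i, j) != (a, b) -> F i j = 0) ->
  \sum_(i < N) \sum_(j < N) F i j = F a b.
Proof.
move=> aN bN F0; rewrite (bigD1 (Ordinal aN))//= [X in _ + X]big1 => [|i ia].
  rewrite addr0 (bigD1 (Ordinal bN))//= [X in _ + X]big1 ?addr0// => j jb.
  by apply: F0; rewrite xpair_eqE negb_and; apply/orP; right.
apply: big1 => j _; apply: F0.
by rewrite xpair_eqE negb_and; apply/orP; left.
Qed.

Section linear.
Context {R : realType}.
Implicit Types (A B : 'M[R]_2) (x z : 'rV[R]_2).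

Lemma continuous_rV2 {T : topologicalType} (h : T -> 'rV[R]_2) (z : T) :
  (forall j, h x 0 j @[x --> z] --> h z 0 j) -> {for z, continuous h}.
Proof.
move=> hj; apply/cvgrPdist_lt => e e0.
near=> x; rewrite norm_rV2_lt !mxE; apply/andP; split.
- by near: x; move/cvgrPdist_lt: (hj 0); exact.
- by near: x; move/cvgrPdist_lt: (hj 1); exact.
Unshelve. all: by end_near. Qed.

Definition box (M : nat) x : int := (`|x| < M%:R)%R%:R.

Lemma box_near M x : `|x| < M%:R -> \forall y \near x, box M y = 1.
Proof.
move=> xM; have : \forall y \near x, `|y| < M%:R.
  have h : `|y| @[y --> x] --> `|x| by exact: norm_continuous.
  exact: (cvgr_lt _ h _ xM).
by apply: filterS => y yM; rewrite /box yM.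
Qed.

Lemma mulmx2E A x j : (x *m A) 0 j = x 0 0 * A 0 j + x 0 1 * A 1 j.
Proof.
by rewrite mxE big_ord_recl big_ord1; congr (_ * _ + x _ _ * A _ _); apply/val_inj.
Qed.

Lemma det2E A : \det A = A 0 0 * A 1 1 - A 0 1 * A 1 0.
Proof.
rewrite (expand_det_row _ 0) big_ord_recl big_ord1 /cofactor !det_mx11 !mxE/=.
rewrite /bump/= addn0 addn1 expr0 expr1 mul1r mulN1r mulrN.
by congr (_ * A _ _ - A _ _ * A _ _); apply/val_inj.
Qed.

Lemma mulmx_det_neq0 A x : \det A != 0 -> x != 0 -> x *m A != 0.
Proof.
move=> A0; apply: contra_neq => xA; rewrite -[x](@mulmxK _ _ _ A) ?xA ?mul0mx//.
by rewrite unitmxE unitfE.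
Qed.

(** While the matrix moves from [A] to [B], the zero moves from [z] to the origin along
    [(1 - t) *: z]; it is the only zero at time [t] and stays inside the box, where the weight is
    locally constant. *)
Lemma winding_linear_homotopy (M : nat) z A B : `|z| < M%:R ->
  (forall t, 0 <= t <= 1 -> \det ((1 - t) *: A + t *: B) != 0) ->
  \forall n \near \oo, winding M n (fun x => (x - z) *m A) (box M) =
                       winding M n (fun x => x *m B) (box M).
Proof.
move=> zM dAB.
have := @winding_homotopy R M
  (fun p : R * 'rV[R]_2 => (p.2 - (1 - p.1) *: z) *m ((1 - p.1) *: A + p.1 *: B)) (fun p => box M p.2).
have -> : (fun x => (((0 : R), x).2 - (1 - ((0 : R), x).1) *: z) *m
    ((1 - ((0 : R), x).1) *: A + ((0 : R), x).1 *: B)) = (fun x => (x - z) *m A).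
  by apply/funext => x /=; rewrite subr0 !scale1r scale0r addr0.
have -> : (fun x => (((1 : R), x).2 - (1 - ((1 : R), x).1) *: z) *m
    ((1 - ((1 : R), x).1) *: A + ((1 : R), x).1 *: B)) = (fun x => x *m B).
  by apply/funext => x /=; rewrite subrr !scale0r add0r subr0 scale1r.
apply => [t x t01 xM|t x t01 Mx]; last by rewrite /box/= ltNge Mx.
have [xz|xz] := eqVneq x ((1 - t) *: z).
  right; have xM' : `|x| < M%:R.
    rewrite xz; apply: le_lt_trans zM; rewrite normrZ ler_piMl//.
    by rewrite ger0_norm; lra.
  have := box_near xM'; rewrite /locally_cst/= (_ : box M x = 1) => [h|]; last by rewrite /box xM'.
  exact: (@cvg_snd _ _ (nbhs t) (nbhs x) _ _ h).
left; split; first by apply: mulmx_det_neq0; [exact: dAB|rewrite /= subr_eq0].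
have c2 j : (p : R * 'rV[R]_2).2 0 j @[p --> (t, x)] --> x 0 j.
  by apply: coord_cvg => /=; exact: cvg_snd.
have c1 : (p : R * 'rV[R]_2).1 @[p --> (t, x)] --> t by exact: cvg_fst.
apply: continuous_rV2 => j.
rewrite (_ : (fun p => _) = (fun p : R * 'rV[R]_2 =>
   (p.2 0 0 - (1 - p.1) * z 0 0) * ((1 - p.1) * A 0 j + p.1 * B 0 j) +
   (p.2 0 1 - (1 - p.1) * z 0 1) * ((1 - p.1) * A 1 j + p.1 * B 1 j))); last first.
  by apply/funext => p; rewrite mulmx2E !mxE.
rewrite mulmx2E !mxE/=.
have c1' : 1 - (p : R * 'rV[R]_2).1 @[p --> (t, x)] --> 1 - t by apply: cvgB => //; exact: cvg_cst.
by apply: cvgD; apply: cvgM; [apply: cvgB|apply: cvgD|apply: cvgB|apply: cvgD] => //;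
  apply: cvgM => //; exact: cvg_cst.
Qed.

(** * Winding of the identity and of a reflection *)

Lemma lattice_coord_lt0 (M n i : nat) :
  (i%:R / n.+1%:R - M%:R < 0 :> R) = (i < M * n.+1)%N.
Proof. by rewrite subr_lt0 ltr_pdivrMr// -natrM ltr_nat. Qed.

Lemma lattice_coord_gt0 (M n i : nat) :
  (0 < i%:R / n.+1%:R - M%:R :> R) = (M * n.+1 < i)%N.
Proof. by rewrite subr_gt0 ltr_pdivlMr// -natrM ltr_nat. Qed.

(** Each index is that of the origin or one less; [0 < n] makes one grid step shorter than [M]. *)
Lemma box_lattice (M n i j : nat) : (0 < M)%N -> (0 < n)%N ->
  (M * n.+1 <= i.+1)%N && (i <= M * n.+1)%N ->
  (M * n.+1 <= j.+1)%N && (j <= M * n.+1)%N -> box M (lattice M n i j : 'rV[R]_2) = 1.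
Proof.
move=> M0 n0 iP jP; rewrite /box (_ : `|_| < _ = true)//.
have aux k : (M * n.+1 <= k.+1)%N && (k <= M * n.+1)%N -> `|k%:R / n.+1%:R - M%:R| < M%:R :> R.
  move=> kP; rewrite ltr_norml ltrBrDr addNr ltrBlDr -natrD ltr_pdivlMr// ltr_pdivrMr//.
  by rewrite mul0r ltr0n -natrM ltr_nat; apply/andP; nia.
by rewrite norm_rV2_lt !mxE/= !aux.
Qed.

Lemma winding_id (M : nat) : (0 < M)%N ->
  \forall n \near \oo, winding M n (fun x => x) (box M : 'rV[R]_2 -> int) = 3.
Proof.
move=> M0; near=> n; have n0 : (0 < n)%N by near: n; exists 1%N.
have sE i j : sector (lattice M n i j : 'rV[R]_2) =
    if (j < M * n.+1)%N then None else Some (i < M * n.+1)%N.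
  by rewrite /sector !mxE/= !lattice_coord_lt0.
have P0 : (0 < M * n.+1)%N by rewrite muln_gt0 M0.
(* Only the square with the origin as its upper right corner carries all three labels: both lower
   corners are [None], and [Some true] is to the left of [Some false]. *)
rewrite /winding (@sum_supp1 _ (M * n.+1).-1 (M * n.+1).-1
  (fun i j => box M (lattice M n i j) * cell M n (fun x => x) i j)); [|lia|lia|].
  by rewrite box_lattice ?mul1r /cell ?sE ?prednK// ?ltnn ?leqnn ?leq_pred.
move=> i j; rewrite xpair_eqE negb_and => ij; rewrite /cell !sE.
have [i1|i1|i1] := ltngtP i.+1 (M * n.+1)%N;
have [j1|j1|j1] := ltngtP j.+1 (M * n.+1)%N;
  rewrite ?(_ : (i < _)%N = true) ?(_ : (j < _)%N = true)
    ?(_ : (i < _)%N = false) ?(_ : (j < _)%N = false) ?mulr0//; lia.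
Unshelve. all: by end_near. Qed.

Definition reflection : 'M[R]_2 :=
  \matrix_(i, j) (if i == j then if i == 0 then - 1 else 1 else 0).

Lemma reflectionE x : x *m reflection = vec (- x 0 0) (x 0 1).
Proof.
apply/rowP => j; rewrite mulmx2E !mxE.
by have [->|->] := ord2 j; rewrite /= ?mulr0 ?mulr1 ?mulrN1 ?addr0 ?add0r.
Qed.

Lemma winding_reflection (M : nat) : (0 < M)%N ->
  \forall n \near \oo,
    winding M n (fun x => x *m reflection) (box M : 'rV[R]_2 -> int) = - 3.
Proof.
move=> M0; near=> n; have n0 : (0 < n)%N by near: n; exists 1%N.
have sE i j : sector (lattice M n i j *m reflection) =
    if (j < M * n.+1)%N then None else Some (M * n.+1 < i)%N.
  by rewrite reflectionE /sector vec0 vec1 !mxE/= oppr_lt0 lattice_coord_lt0 lattice_coord_gt0.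
have P0 : (0 < M * n.+1)%N by rewrite muln_gt0 M0.
(* After the reflection [Some true] labels the nodes strictly to the right of the axis, so the
   turning square now has the origin as its upper left corner and is traversed in the opposite
   sense. *)
rewrite /winding (@sum_supp1 _ (M * n.+1) (M * n.+1).-1
  (fun i j => box M (lattice M n i j) * cell M n (fun x => x *m reflection) i j)); [|nia|lia|].
  by rewrite box_lattice ?mul1r /cell ?sE ?prednK// ?ltnn ?leqnn ?ltnSn ?leqnSn ?leq_pred.
move=> i j; rewrite xpair_eqE negb_and => ij; rewrite /cell !sE.
move: P0 ij; move: (box _ _) => w; move: (M * n.+1)%N => P P0 ij.
rewrite ltnS; have [i1|i1|i1] := ltngtP P i; have [j1|j1|j1] := ltngtP j.+1 P;
  rewrite ?mulr0//; lia.
Unshelve. all: by end_near. Qed.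

(** * Paths of invertible matrices *)

Definition mx2 (a b c d : R) : 'M[R]_2 :=
  \matrix_(i, j) (if i == 0 then if j == 0 then a else b else if j == 0 then c else d).

Lemma mx2_eta A : A = mx2 (A 0 0) (A 0 1) (A 1 0) (A 1 1).
Proof.
by apply/matrixP => i j; rewrite mxE; have [->|->] := ord2 i; have [->|->] := ord2 j.
Qed.

Lemma det_mx2 a b c d : \det (mx2 a b c d) = a * d - b * c.
Proof. by rewrite det2E !mxE. Qed.

Lemma winding_linear_step (M : nat) A B : (0 < M)%N ->
  (forall t, 0 <= t <= 1 -> \det ((1 - t) *: A + t *: B) != 0) ->
  \forall n \near \oo, winding M n (fun x => x *m A) (box M) =
                       winding M n (fun x => x *m B) (box M).
Proof.
move=> M0 /(@winding_linear_homotopy M 0) H; have := H _; rewrite normr0 ltr0n => /(_ M0).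
by rewrite (_ : (fun x => (x - 0) *m A) = (fun x => x *m A))//;
  apply/funext => x; rewrite subr0.
Qed.

(** The sign of the determinant separates the two components of the invertible matrices: broken
    lines of invertible matrices lead from [A] to the identity or to the reflection, whose windings
    are known. *)
Lemma winding_linear (M : nat) z A : `|z| < M%:R -> \det A != 0 ->
  \forall n \near \oo,
    winding M n (fun x => (x - z) *m A) (box M) = sgz (\det A) * 3.
Proof.
move=> zM dA; have M0 : (0 < M)%N.
  by rewrite -(ltr0n R); exact: le_lt_trans zM.
have hz := @winding_linear_homotopy M z A A zM _.
have {hz} : \forall n \near \oo, winding M n (fun x => (x - z) *m A) (box M) =
    winding M n (fun x => x *m A) (box M).
  by apply: hz => t _; rewrite -scalerDl subrK scale1r.
have I1 : (fun x => x *m mx2 1 0 0 1) = (fun x => x).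
  by apply/funext => x; apply/rowP => j; rewrite mulmx2E !mxE;
    have [->|->] := ord2 j; rewrite /= ?mulr0 ?mulr1 ?addr0 ?add0r.
have rE : reflection = mx2 (- 1) 0 0 1.
  apply/matrixP => i j; rewrite !mxE.
  by have [->|->] := ord2 i; have [->|->] := ord2 j.
have comb a b c d a' b' c' d' t :
    \det ((1 - t) *: mx2 a b c d + t *: mx2 a' b' c' d') =
    (1 - t) ^+ 2 * (a * d - b * c) + t * (1 - t) * (a * d' + d * a' - b * c' - c * b')
    + t ^+ 2 * (a' * d' - b' * c').
  by rewrite det2E !mxE/=; ring.
have pos (x y w t : R) : 0 <= t <= 1 -> 0 < x -> 0 <= y -> 0 < w ->
    0 < (1 - t) ^+ 2 * x + t * (1 - t) * y + t ^+ 2 * w :> R.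
  move=> /andP[t0 t1] x0 y0 w0.
  have h1 : 0 <= (1 - t) ^+ 2 * x by rewrite mulr_ge0 ?sqr_ge0// ltW.
  have h2 : 0 <= t * (1 - t) * y by rewrite !mulr_ge0// subr_ge0.
  have [->|tn0] := eqVneq t 0; first by rewrite !expr2; lra.
  have h3 : 0 < t ^+ 2 * w by rewrite mulr_gt0// exprn_gt0// lt_def tn0.
  by lra.
(* The determinant of a segment between matrices with determinants of the same sign
   [e] does not vanish if the mixed term of this quadratic form has sign [e]. *)
have path a b c d a' b' c' d' (e : R) : e ^+ 2 = 1 ->
  0 < e * (a * d - b * c) -> 0 <= e * (a * d' + d * a' - b * c' - c * b') ->
  0 < e * (a' * d' - b' * c') ->
  \forall n \near \oo, winding M n (fun x => x *m mx2 a b c d) (box M) =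
                       winding M n (fun x => x *m mx2 a' b' c' d') (box M).
  move=> e2 h1 h2 h3; apply: winding_linear_step => // t t01; rewrite comb.
  have := pos _ _ _ _ t01 h1 h2 h3.
  by apply: contraTneq => h; rewrite -leNgt -[leRHS](mulr0 e) -h le_eqVlt; apply/orP; left; apply/eqP; ring.
have [a [b [c [d AE]]]] : exists a b c d, A = mx2 a b c d.
  by exists (A 0 0), (A 0 1), (A 1 0), (A 1 1); exact: mx2_eta.
have [dpos|dneg|] := ltgtP (\det A) 0; last by move/eqP; rewrite (negbTE dA).
- rewrite ltr0_sgz// mulN1r; move: dpos; rewrite AE det_mx2 => dpos.
  have toR : \forall n \near \oo, winding M n (fun x => x *m mx2 a b c d) (box M) =
      winding M n (fun x => x *m mx2 (-1) 0 0 1) (box M).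
    (* With diag(-1, 1) as target the mixed term is [a - d], which has the required sign if
       [a <= d]. Otherwise diag(1, -1) is reached first, and the swap of coordinates connects it to
       diag(-1, 1). *)
    have [ad|ad] := leP a d.
      by apply: (path _ _ _ _ _ _ _ _ (-1)); rewrite ?sqrrN ?expr1n//; lra.
    have p1 : \forall n \near \oo, winding M n (fun x => x *m mx2 a b c d) (box M) =
        winding M n (fun x => x *m mx2 1 0 0 (-1)) (box M).
      by apply: (path _ _ _ _ _ _ _ _ (-1)); rewrite ?sqrrN ?expr1n//; lra.
    have p2 : \forall n \near \oo, winding M n (fun x => x *m mx2 1 0 0 (-1)) (box M) =
        winding M n (fun x => x *m mx2 0 1 1 0) (box M).
      by apply: (path _ _ _ _ _ _ _ _ (-1)); rewrite ?sqrrN ?expr1n//; lra.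
    have p3 : \forall n \near \oo, winding M n (fun x => x *m mx2 0 1 1 0) (box M) =
        winding M n (fun x => x *m mx2 (-1) 0 0 1) (box M).
      by apply: (path _ _ _ _ _ _ _ _ (-1)); rewrite ?sqrrN ?expr1n//; lra.
    by near=> n; rewrite (near p1 n)// (near p2 n)// (near p3 n).
  have := winding_reflection M0; rewrite rE => hr h.
  by near=> n; rewrite (near h n)// (near toR n)// (near hr n).
- rewrite gtr0_sgz// mul1r; move: dneg; rewrite AE det_mx2 => dneg.
  have toI : \forall n \near \oo, winding M n (fun x => x *m mx2 a b c d) (box M) =
      winding M n (fun x => x *m mx2 1 0 0 1) (box M).
    (* With the identity as target the mixed term is the trace. If it is negative, the path goes to
       minus the identity and then through a quarter turn to the identity. *)
    have [ad|ad] := leP 0 (a + d).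
      by apply: (path _ _ _ _ _ _ _ _ 1); rewrite ?expr1n//; lra.
    have p1 : \forall n \near \oo, winding M n (fun x => x *m mx2 a b c d) (box M) =
        winding M n (fun x => x *m mx2 (-1) 0 0 (-1)) (box M).
      by apply: (path _ _ _ _ _ _ _ _ 1); rewrite ?expr1n//; lra.
    have p2 : \forall n \near \oo, winding M n (fun x => x *m mx2 (-1) 0 0 (-1)) (box M) =
        winding M n (fun x => x *m mx2 0 1 (-1) 0) (box M).
      by apply: (path _ _ _ _ _ _ _ _ 1); rewrite ?expr1n//; lra.
    have p3 : \forall n \near \oo, winding M n (fun x => x *m mx2 0 1 (-1) 0) (box M) =
        winding M n (fun x => x *m mx2 1 0 0 1) (box M).
      by apply: (path _ _ _ _ _ _ _ _ 1); rewrite ?expr1n//; lra.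
    by near=> n; rewrite (near p1 n)// (near p2 n)// (near p3 n).
  have := winding_id M0; rewrite -I1 => hr h.
  by near=> n; rewrite (near h n)// (near toI n)// (near hr n).
Unshelve. all: by end_near. Qed.

End linear.

(** * Regular zeros *)

Lemma near_seq {I : eqType} {T : Type} (F : set_system T) {FF : Filter F}
    (s : seq I) (P : I -> T -> Prop) :
  (forall i, i \in s -> \forall x \near F, P i x) ->
  \forall x \near F, forall i, i \in s -> P i x.
Proof.
elim: s => [|i s IH] h; first by apply: filterE.
have hs := IH (fun j js => h j (@mem_behead _ (i :: s) j js)).
have hi := h i (mem_head _ _).
near=> x => j; rewrite inE => /orP[/eqP->|]; first by near: x.
by move: j; near: x.
Unshelve. all: by end_near. Qed.

Section regular.
Context {R : realType}.
Implicit Types (U : set 'rV[R]_2) (g h : 'rV[R]_2 -> 'rV[R]_2).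

Definition ind {T : Type} (U : set T) (x : T) : int := (x \in U)%:R.

Lemma ind1 {T : Type} (U : set T) x : U x -> ind U x = 1.
Proof. by move=> Ux; rewrite /ind mem_set. Qed.

Lemma ind0 {T : Type} (U : set T) x : ~ U x -> ind U x = 0.
Proof. by move=> Ux; rewrite /ind memNset. Qed.

Lemma ind_near {T : topologicalType} (U : set T) x :
  ~ frontier U x -> locally_cst (ind U) x.
Proof.
move=> fU; have [Ux|Ux] := pselect (U° x).
  rewrite /locally_cst (ind1 (interior_subset Ux)).
  by apply: filterS Ux => y; exact: ind1.
have : (~` U)° x by rewrite interiorC => cx; apply: fU.
move=> nU; rewrite /locally_cst (ind0 (interior_subset nU)).
by apply: filterS nU => y; exact: ind0.
Qed.

(** Excision: the winding is additive in the weight, and the difference of the weights vanishes near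
    the zeros of [g]. *)
Lemma winding_eq_weight (M : nat) g (chi1 chi2 : 'rV[R]_2 -> int) :
  (forall x : 'rV[R]_2, `|x| <= M%:R ->
    g x != 0 /\ {for x, continuous g} \/ \forall y \near x, chi1 y = chi2 y) ->
  \forall n \near \oo, winding M n g chi1 = winding M n g chi2.
Proof.
move=> h; have : \forall n \near \oo, winding M n g (fun x => chi1 x - chi2 x) = 0.
  apply: winding_vanish => x /h[|near12]; [by left|right].
  by apply: filterS near12 => y ->; rewrite subrr.
apply: filterS => n e0; apply/eqP; rewrite -subr_eq0 -[X in _ == X]e0 /winding -sumrB.
apply/eqP/eq_bigr => i _; rewrite -sumrB; apply/eq_bigr => j _.
by rewrite mulrBl.
Qed.

Lemma winding_sum (M n : nat) g (I : Type) (s : seq I) (chi : I -> 'rV[R]_2 -> int) :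
  winding M n g (fun x => \sum_(i <- s) chi i x) = \sum_(i <- s) winding M n g (chi i).
Proof.
rewrite /winding [RHS]exchange_big; apply: eq_bigr => i _/=.
rewrite [RHS]exchange_big; apply: eq_bigr => j _ /=.
by rewrite mulr_suml.
Qed.

Lemma continuous_mulmx2 {T : topologicalType} (h : T -> 'rV[R]_2) (A : 'M[R]_2) (z : T) :
  {for z, continuous h} -> {for z, continuous (fun x => h x *m A)}.
Proof.
move=> hz; apply: continuous_rV2 => j.
rewrite (_ : (fun x => _) = (fun x => h x 0 0 * A 0 j + h x 0 1 * A 1 j)); last first.
  by apply/funext => x; rewrite mulmx2E.
rewrite mulmx2E; apply: cvgD; apply: cvgM; try exact: cvg_cst; exact: coord_cvg.
Qed.

Lemma mulmx_bound (A : 'M[R]_2) : exists2 K : R, 0 < K & forall v : 'rV[R]_2, `|v *m A| <= K * `|v|.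
Proof.
exists (1 + `|A 0 0| + `|A 0 1| + `|A 1 0| + `|A 1 1|).
  by rewrite -!addrA ltr_pwDl// !addr_ge0.
move=> v; have := norm_rV2_le v `|v|; rewrite lexx => /esym/andP[v0 v1].
have aux (a b c d e : R) : `|a| + `|b| + e <= c -> 0 <= e -> `|v 0 0 * a + v 0 1 * b| <= c * `|v|.
  move=> abc e0; apply: (le_trans (ler_normD _ _)); rewrite !normrM.
  apply: (@le_trans _ _ ((`|a| + `|b|) * `|v|)).
    by rewrite mulrDl !(mulrC `|v 0 _|) lerD// ler_wpM2l.
  by rewrite ler_wpM2r//; lra.
rewrite norm_rV2_le !mulmx2E; apply/andP; split.
  by apply: (aux _ _ _ 0 (1 + `|A 0 1| + `|A 1 1|)); rewrite ?addr_ge0//; lra.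
by apply: (aux _ _ _ 0 (1 + `|A 0 0| + `|A 1 0|)); rewrite ?addr_ge0//; lra.
Qed.

(** If [K] bounds the inverse of the differential, the remainder of [g] at [x] is at most
    [|x - z| / (2 * K)] near [z]. A zero of the combination would make the linear part equal to
    [-(1 - t)] times this remainder, whence [|x - z| <= |x - z| / 2]. *)
Lemma regular_zero_radius g z : differentiable g z -> g z = 0 -> \det ('J g z) != 0 ->
  exists2 r : R, 0 < r & forall x : 'rV[R]_2, `|x - z| <= r -> x != z ->
    forall t, 0 <= t <= 1 -> (1 - t) *: g x + t *: ((x - z) *m 'J g z) != 0.
Proof.
move=> dg gz dJ.
have [K K0 hK] := mulmx_bound (invmx ('J g z)).
have lb (v : 'rV[R]_2) : `|v| <= K * `|v *m 'J g z|.
  have Ju : 'J g z \in unitmx by rewrite unitmxE unitfE.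
  by have := hK (v *m 'J g z); rewrite (mulmxK Ju).
have := diff_locally dg; move=> /eqaddoP/(_ ((2 * K)^-1)).
rewrite invr_gt0 mulr_gt0// => /(_ isT) /nbhs_ballP[r /= r0 hr].
exists (r / 2); first by rewrite divr_gt0.
move=> x xz xnz t /andP[t0 t1].
have := hr (x - z); rewrite -ball_normE /ball_/= sub0r normrN !fctE/= subrK gz add0r.
have xr : `|x - z| < r by lra.
move=> /(_ xr).
have <- : (x - z) *m 'J g z = 'd g z (x - z) by rewrite /jacobian mul_rV_lin1.
move=> hx.
apply/negP => /eqP h0.
have e1 : (x - z) *m 'J g z = - ((1 - t) *: (g x - (x - z) *m 'J g z)).
  move: ((x - z) *m _) h0 => L h0; rewrite -[LHS]subr0 -h0.
  by apply/rowP => j; rewrite !mxE; ring.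
have xz0 : 0 < `|x - z| by rewrite normr_gt0 subr_eq0.
have := lb (x - z); rewrite e1 normrN normrZ.
apply/negP; rewrite -ltNge.
apply: (@le_lt_trans _ _ (K * (1 * ((2 * K)^-1 * `|x - z|)))).
  rewrite ler_wpM2l ?(ltW K0)// ler_pM//.
  by rewrite ger0_norm; lra.
rewrite mul1r invfM mulrA mulrCA divff ?gt_eqF// mulr1; lra.
Qed.

(** On the ball, [g] is deformed linearly to its differential at [z]; as [z] is the only zero of the
    latter, excision replaces the ball by the box. *)
Lemma winding_local_zero (M : nat) g (z : 'rV[R]_2) (r : R) : continuous g -> 0 < r ->
  (forall x : 'rV[R]_2, `|x - z| <= r -> `|x| < M%:R) -> \det ('J g z) != 0 ->
  (forall x : 'rV[R]_2, `|x - z| <= r -> x != z ->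
    forall t, 0 <= t <= 1 -> (1 - t) *: g x + t *: ((x - z) *m 'J g z) != 0) ->
  \forall n \near \oo, winding M n g (ind (ball z r)) = sgz (\det ('J g z)) * 3.
Proof.
move=> cg r0 rM dJ hr.
have zM : `|z| < M%:R by apply: rM; rewrite subrr normr0 ltW.
have ballE (x : 'rV[R]_2) : ball z r x = (`|x - z| < r) by rewrite -ball_normE /ball_/= distrC.
pose B : 'rV[R]_2 -> int := ind (ball z r).
have near_out (x : 'rV[R]_2) : r < `|x - z| -> @locally_cst 'rV[R]_2 B x.
  move=> rx; rewrite /locally_cst /B (ind0 (x := x)); last by rewrite ballE; apply/negP; rewrite -leNgt ltW.
  have c : `|y - z| @[y --> x] --> `|x - z|.
    have h : y - z @[y --> x] --> x - z by apply: (cvgB (FF := nbhs_filter x)); [move=> ?; exact|exact: cvg_cst].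
    exact: cvg_norm h.
  have : \forall y \near x, r < `|y - z| by exact: (cvgr_gt _ c _ rx).
  apply: filterS => y ry.
  by apply: ind0; rewrite ballE; apply/negP; rewrite -leNgt ltW.
have near_in (x : 'rV[R]_2) : `|x - z| < r -> @locally_cst 'rV[R]_2 B x.
  move=> rx; rewrite /locally_cst /B (ind1 (x := x)); last by rewrite ballE.
  have c : `|y - z| @[y --> x] --> `|x - z|.
    have h : y - z @[y --> x] --> x - z by apply: (cvgB (FF := nbhs_filter x)); [move=> ?; exact|exact: cvg_cst].
    exact: cvg_norm h.
  have : \forall y \near x, `|y - z| < r by exact: (cvgr_lt _ c _ rx).
  apply: filterS => y ry.
  by apply: ind1; rewrite ballE.
pose L (x : 'rV[R]_2) := (x - z) *m 'J g z.
have cL : continuous L.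
  move=> x; rewrite /L.
  have := @continuous_mulmx2 'rV[R]_2 (fun y => y - z) ('J g z) x; apply.
  by apply: (cvgB (FF := nbhs_filter x)); [move=> ?; exact|exact: cvg_cst].
have s1 : \forall n \near \oo, winding M n g B = winding M n L B.
  have := @winding_homotopy R M (fun p : R * 'rV[R]_2 => (1 - p.1) *: g p.2 + p.1 *: L p.2)
    (fun p => B p.2).
  have -> : (fun x => (1 - ((0 : R), x).1) *: g ((0 : R), x).2 + ((0 : R), x).1 *: L ((0 : R), x).2) = g.
    by apply/funext => x /=; rewrite subr0 !scale1r scale0r addr0.
  have -> : (fun x => (1 - ((1 : R), x).1) *: g ((1 : R), x).2 + ((1 : R), x).1 *: L ((1 : R), x).2) = L.
    by apply/funext => x /=; rewrite subrr !scale1r scale0r add0r.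
  apply => [t x t01 xM|t x t01 Mx]; last first.
    apply: ind0; rewrite ballE; by move=> /ltW/rM; apply/negP; rewrite -leNgt.
  have lc : @locally_cst 'rV[R]_2 B x ->
      @locally_cst (R * 'rV[R]_2)%type (fun p : R * 'rV[R]_2 => B p.2) (t, x).
    by move=> hx; exact: (@cvg_snd _ _ (nbhs t) (nbhs x) _ _ hx).
  have [xr|xr] := ltP r `|x - z|; first by right; exact (lc (near_out x xr)).
  have [xz|xz] := eqVneq x z.
    have xr' : `|x - z| < r by rewrite xz subrr normr0.
    by right; exact (lc (near_in x xr')).
  left; split; first exact: hr.
  have c1 : (p : R * 'rV[R]_2).1 @[p --> (t, x)] --> t by exact: cvg_fst.
  have c2 : (p : R * 'rV[R]_2).2 @[p --> (t, x)] --> x by exact: cvg_snd.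
  apply: cvgD; apply: cvgZ => //.
  - by apply: cvgB => //; exact: cvg_cst.
  - exact: (cvg_comp _ _ c2 (cg x)).
  - exact: (cvg_comp _ _ c2 (cL x)).
have s2 : \forall n \near \oo, winding M n L B = winding M n L (box M).
  apply: winding_eq_weight => x xM; have [->|xz] := eqVneq x z; last first.
    by left; split; [apply: mulmx_det_neq0; rewrite ?subr_eq0|exact: cL].
  right; have h := box_near zM; have h' : @locally_cst 'rV[R]_2 B z.
    by apply: near_in; rewrite subrr normr0.
  have Bz : B z = 1 by apply: ind1; exact: ballxx.
  by near=> y; rewrite (near h y)// (near h' y)// Bz.
have s3 := winding_linear zM dJ.
by near=> n; rewrite (near s1 n)// (near s2 n)// (near s3 n).
Unshelve. all: by end_near. Qed.

(** Near every zero of [g] the indicator of [U] agrees with the sum of the indicators of small balls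
    around the zeros in [U]. By excision the winding is the sum of the local ones. *)
Lemma winding_regular (M : nat) g U : continuous g -> open U ->
  (forall x : 'rV[R]_2, U x -> `|x| < M%:R) ->
  (forall x, frontier U x -> g x != 0) ->
  (forall x, differentiable g x) -> regular_value g U 0 -> regular_degree g U 0 != 0 ->
  \forall n \near \oo, winding M n g (ind U) = regular_degree g U 0 * 3.
Proof.
move=> cg oU UM fU dg reg d0.
pose A := U `&` g @^-1` [set 0].
have gA z : A z -> g z = 0 by case.
have UA z : A z -> U z by case.
(* A sum with infinite support is 0 by convention. Since all signs at regular zeros are nonzero, the
   support is [A] itself, and a nonzero degree forces it to be finite. *)
have finA : finite_set A.
  apply: contrapT => infA; move: d0; rewrite /regular_degree fsbig_dflt ?eqxx//.
  move=> fin; apply: infA; apply: sub_finite_set fin => z Az; split => //=.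
  by apply/eqP; rewrite sgz_eq0; apply: reg; [exact: UA|exact: gA].
have hr z : exists r : R, A z -> [/\ 0 < r, forall x : 'rV[R]_2, `|x - z| <= r -> U x &
    forall x : 'rV[R]_2, `|x - z| <= r -> x != z ->
      forall t, 0 <= t <= 1 -> (1 - t) *: g x + t *: ((x - z) *m 'J g z) != 0].
  have [Az|nAz] := pselect (A z); last by exists 0.
  have [r1 r10 h1] := regular_zero_radius (dg z) (gA z Az) (reg z (UA z Az) (gA z Az)).
  have : nbhs z U by apply: open_nbhs_nbhs; split => //; exact: UA.
  move=> /nbhs_ballP[r2 /= r20 h2].
  (* [r1] isolates the zero and controls the linearization, [r2 / 2] keeps the closed ball inside
     [U]. *)
  exists (Num.min r1 (r2 / 2)) => _; split.
  - by rewrite lt_min r10 divr_gt0.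
  - move=> x; rewrite le_min => /andP[_ xz]; apply: h2.
    by rewrite -ball_normE /ball_/= distrC; lra.
  - by move=> x; rewrite le_min => /andP[xz _]; exact: h1.
have [r {}hr] := choice hr.
pose s := finmap.enum_fset (fset_set A).
have sA z : (z \in s) = (z \in A) by rewrite /s -in_fset_set.
have degE : regular_degree g U 0 = \sum_(z <- s) sgz (\det ('J g z)).
  by rewrite /regular_degree fsbig_finite.
pose B (z x : 'rV[R]_2) := ind (ball z (r z)) x.
have s1 : \forall n \near \oo, winding M n g (ind U) =
    winding M n g (fun x => \sum_(z <- s) B z x).
  apply: winding_eq_weight => x xM.
  have [gx|gx] := eqVneq (g x) 0; last by left; split => //; exact: cg.
  right; have nfU : ~ frontier U x by move=> /fU; rewrite gx eqxx.
  have nU := ind_near nfU.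
  have [Ux|Ux] := pselect (U x).
    have Ax : A x by [].
    (* The balls may overlap, but by the case [t = 0] of the radius condition the closed ball around
       another zero cannot contain the zero [x]. *)
    have far z : z \in s -> \forall y \near x, z != x -> B z y = 0.
      rewrite sA => /set_mem Az; have [zx|zx] := eqVneq z x; first by near=> y; rewrite ?zx ?eqxx.
      have rzx : r z < `|x - z|.
        have [r0 _ h] := hr z Az; rewrite ltNge; apply/negP => xz.
        have := h x xz; rewrite eq_sym => /(_ zx 0); rewrite lexx ler01 => /(_ isT).
        by rewrite gx scaler0 scale0r addr0 eqxx.
      have c : `|y - z| @[y --> x] --> `|x - z|.
        have h : y - z @[y --> x] --> x - z.
          by apply: (cvgB (FF := nbhs_filter x)); [move=> ?; exact|exact: cvg_cst].
        exact: cvg_norm h.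
      have : \forall y \near x, r z < `|y - z| by exact: (cvgr_gt _ c _ rzx).
      apply: filterS => y ry _; apply: ind0.
      by rewrite -ball_normE /ball_/= distrC; apply/negP; rewrite -leNgt ltW.
    have far' : \forall y \near x, forall z, z \in s -> z != x -> B z y = 0 := near_seq far.
    have bx : \forall y \near x, B x y = 1.
      have := nbhsx_ballx x (r x); have [r0 _ _] := hr x Ax; move=> /(_ r0).
      by apply: filterS => y; exact: ind1.
    near=> y; rewrite (near nU y)// ind1// (bigD1_seq x)/= ?sA ?mem_set ?finmap.fset_uniq//.
    rewrite (near bx y)// big1_seq ?addr0// => z /andP[zx zs].
    move: z zs zx; near: y; exact: far'.
  near=> y; rewrite (near nU y)// (ind0 Ux) big1_seq// => z; rewrite sA => /andP[_ /set_mem Az].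
  apply: ind0; rewrite -ball_normE /ball_/= => zy.
  have [_ h _] := hr z Az; have Uy : U y by apply: h; rewrite distrC ltW.
  have : ind U y = ind U x by rewrite (near nU y).
  by rewrite (ind1 Uy) (ind0 Ux).
have s2 : \forall n \near \oo, forall z, z \in s ->
    winding M n g (B z) = sgz (\det ('J g z)) * 3.
  apply: near_seq => z; rewrite sA => /set_mem Az; have [r0 h1 h2] := hr z Az.
  apply: winding_local_zero => //; first by move=> x /h1/UM.
  by apply: reg; [exact: UA|exact: gA].
near=> n; rewrite (near s1 n)// winding_sum degE mulr_suml.
by apply: eq_big_seq => z zs; rewrite (near s2 n).
Unshelve. all: by end_near. Qed.
End regular.

(** * Calculus on the segment *)

Section segment.
Context {R : realType} (T : {posnum R}).
Implicit Types (t s : seg T) (u v w : seg T -> R).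

Lemma segval_itv t : 0 <= segval t <= T%:num.
Proof. by have /set_mem := valP t; rewrite /= in_itv. Qed.

Definition clamp (x : R) : R := Num.max 0 (Num.min x T%:num).

Lemma clamp_itv x : 0 <= clamp x <= T%:num.
Proof. by rewrite /clamp le_max lexx/= ge_max ge_min lexx orbT andbT. Qed.

Lemma clamp_id x : 0 <= x <= T%:num -> clamp x = x.
Proof. by move=> /andP[x0 xT]; rewrite /clamp min_l// max_r. Qed.

Lemma clamp_dist x y : `|clamp x - clamp y| <= `|x - y|.
Proof.
have T0 : 0 < T%:num :> R by [].
have h1 := ler_norm (x - y); have h2 := ler_norm (y - x); rewrite distrC in h2.
rewrite /clamp /Num.max /Num.min.
by do !case: ifPn; rewrite -?leNgt => *; rewrite ler_norml; apply/andP; split; lra.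
Qed.

Lemma clamp_mem x : clamp x \in `[0, T%:num]%classic.
Proof. by rewrite inE/= in_itv/= clamp_itv. Qed.

(** A retraction of the line onto the segment. Composing with it extends functions on [seg T] to the
    line, where the mean value theorem and integration are available. *)
Definition projseg x : seg T := exist _ (clamp x) (clamp_mem x).

Lemma segval_projseg x : segval (projseg x) = clamp x. Proof. by []. Qed.

Lemma projsegK t : projseg (segval t) = t.
Proof. by apply: segval_inj; rewrite segval_projseg clamp_id// segval_itv. Qed.

Lemma nbhs_segP t (A : set (seg T)) :
  nbhs t A <-> exists2 e : R, 0 < e & forall s, `|segval t - segval s| < e -> A s.
Proof.
split=> [/nbhs_ballP[e /= e0 eA]|[e e0 eA]]; first by exists e => // s; exact: (eA s).
by apply/nbhs_ballP; exists e => //= s; exact: (eA s).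
Qed.

Lemma projseg_continuous : continuous projseg.
Proof.
move=> x A /nbhs_segP[e e0 eA]; apply/nbhs_ballP; exists e => //= y xy.
by apply: eA; rewrite !segval_projseg; apply: le_lt_trans (clamp_dist _ _) xy.
Qed.

Lemma continuous_segP w : continuous w <->
  forall t (e : R), 0 < e -> exists2 d : R, 0 < d &
    forall s, `|segval t - segval s| < d -> `|w t - w s| < e.
Proof.
split=> [cw t e e0|h t].
  by have /(cvgrPdist_lt (FF := nbhs_filter t))/(_ e e0)/nbhs_segP := cw t.
by apply/(cvgrPdist_lt (FF := nbhs_filter t)) => e e0; apply/nbhs_segP; exact: h.
Qed.

(** Cleared of the quotient, the estimate also holds at [s = t] and is easily passed to pointwise
    limits. *)
Lemma cvg_diffquotP u t (l : R) : diffquot u t s @[s --> t^'] --> l <->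
  forall e : R, 0 < e -> exists2 d : R, 0 < d & forall s, `|segval t - segval s| < d ->
    `|u s - u t - l * (segval s - segval t)| <= e * `|segval s - segval t|.
Proof.
have eqE s : s != t -> `|u s - u t - l * (segval s - segval t)| =
    `|l - diffquot u t s| * `|segval s - segval t|.
  move=> st; have st' : segval s - segval t != 0 by rewrite subr_eq0 (inj_eq (@segval_inj R T)).
  by rewrite -normrM mulrBl /diffquot mulfVK// distrC.
split=> [/cvgrPdist_le ul e e0|h].
  have /nbhs_segP[d d0 dP] := ul e e0; exists d => // s ts.
  have [->|st] := eqVneq s t; first by rewrite !subrr mulr0 subr0 normr0 mulr0.
  by rewrite eqE// ler_wpM2r//; exact: dP.
apply/cvgrPdist_le => e e0; have [d d0 dP] := h e e0.
apply/nbhs_segP; exists d => // s ts st.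
have := dP s ts; rewrite eqE// ler_pM2r// normr_gt0 subr_eq0.
by rewrite (inj_eq (@segval_inj R T)).
Qed.

Lemma is_C1_of_derivative u w : continuous w ->
  (forall t (e : R), 0 < e -> exists2 d : R, 0 < d & forall s, `|segval t - segval s| < d ->
    `|u s - u t - w t * (segval s - segval t)| <= e * `|segval s - segval t|) ->
  is_C1 u /\ dseg u = w.
Proof.
move=> cw h; have hw t : diffquot u t s @[s --> t^'] --> w t by apply/cvg_diffquotP => e; exact: h.
have dE : dseg u = w by apply/funext => t; exact: dseg_eq.
by split => //; split; [move=> t; apply/cvg_ex; exists (w t)|rewrite dE].
Qed.

(** The estimate makes [V] the derivative of [U]; added to the one with [x] and [y] exchanged, it
    shows that [V] is Lipschitz with constant [2 * K], hence continuous. *)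
Lemma is_C1_quadratic (U V : R -> R) (K : R) :
  (forall x y, `|U y - U x - V x * (y - x)| <= K * (y - x) ^+ 2) ->
  is_C1 (U \o @segval R T) /\ dseg (U \o @segval R T) = V \o @segval R T.
Proof.
move=> UV; have K0 : 0 <= K.
  by have := UV 0 1; rewrite subr0 expr1n !mulr1; exact: le_trans.
have VL x y : `|V x - V y| <= 2 * K * `|x - y|.
  have [->|xy] := eqVneq x y; first by rewrite !subrr normr0 mulr0.
  have xy0 : 0 < `|x - y| by rewrite normr_gt0 subr_eq0.
  rewrite -(ler_pM2r xy0) -normrM -[leRHS]mulrA -expr2 real_normK ?num_real//.
  have -> : (V x - V y) * (x - y) =
      (U y - U x - V x * (y - x)) + (U x - U y - V y * (x - y)) by ring.
  apply: (le_trans (ler_normD _ _)).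
  have := UV x y; have := UV y x; rewrite -(sqrrN (y - x)) opprB; lra.
apply: is_C1_of_derivative.
  apply/continuous_segP => t e e0; exists (e / (2 * K + 1)).
    by rewrite divr_gt0//; lra.
  move=> s; rewrite ltr_pdivlMr; last by lra.
  move=> h; apply: (le_lt_trans (VL _ _)); have := normr_ge0 (segval t - segval s); lra.
move=> t e e0; exists (e / (K + 1)); first by rewrite divr_gt0//; lra.
move=> s; rewrite ltr_pdivlMr; last by lra.
move=> h; apply: (le_trans (UV _ _)).
rewrite -real_normK ?num_real// expr2 mulrA ler_wpM2r// distrC.
by have := normr_ge0 (segval t - segval s); lra.
Qed.

Lemma continuous_projseg w : continuous w -> continuous (w \o projseg).
Proof. by move=> cw x; apply: continuous_comp; [exact: projseg_continuous|exact: cw]. Qed.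

Lemma is_derive_projseg u (x : R) : is_C1 u -> 0 < x < T%:num ->
  is_derive x 1 (u \o projseg) (dseg u (projseg x)).
Proof.
move=> [du _] /andP[x0 xT].
have hx : clamp x = x by rewrite clamp_id// !ltW.
have /cvg_diffquotP h : diffquot u (projseg x) s @[s --> (projseg x)^'] --> dseg u (projseg x) by exact: du.
have c : h^-1 *: ((u \o projseg) (h *: (1 : R) + x) - (u \o projseg) x) @[h --> 0^'] --> dseg u (projseg x).
  apply/cvgrPdist_le => e e0; have [d d0 dP] := h e e0.
  apply/nbhs_ballP; exists (Num.min d (Num.min x (T%:num - x))).
    by rewrite /= !lt_min d0 x0 subr_gt0 xT.
  move=> k; rewrite /ball/= sub0r normrN !lt_min => /and3P[kd kx kT] k0.
  have kx' : clamp (k + x) = k + x.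
    by move: kx kT; rewrite !ltr_norml => /andP[? ?] /andP[? ?]; apply: clamp_id; lra.
  rewrite (_ : k *: (1 : R) = k); last exact: mulr1.
  have := dP (projseg (k + x)); rewrite !segval_projseg kx' hx.
  rewrite opprD addrCA subrr addr0 normrN addrK => /(_ kd) ub.
  have k0' : 0 < `|k| by rewrite normr_gt0.
  rewrite -(ler_pM2r k0') -normrM mulrBl /= -[_ *: _]/(k^-1 * _).
  by rewrite mulrC mulrAC mulVf// mul1r distrC mulrC.
apply: DeriveDef; first by apply/cvg_ex; exists (dseg u (projseg x)).
exact/cvg_lim.
Qed.

Lemma mean_value u s t : is_C1 u -> segval s < segval t ->
  exists r, segval s < segval r < segval t /\ u t - u s = dseg u r * (segval t - segval s).
Proof.
move=> cu st; have [/andP[s0 sT] /andP[t0 tT]] := (segval_itv s, segval_itv t).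
have [||c] := @MVT R (u \o projseg) (dseg u \o projseg) (segval s) (segval t) st.
- move=> x; rewrite in_itv/= => /andP[sx xt]; apply: is_derive_projseg => //.
  by rewrite (le_lt_trans s0 sx) (lt_le_trans xt tT).
- by apply: continuous_subspaceT; apply: continuous_projseg; exact: is_C1_continuous.
rewrite in_itv/= !projsegK => /andP[sc ct] e; exists (projseg c); split => //.
rewrite segval_projseg clamp_id ?sc//.
by rewrite (le_trans s0 (ltW sc)) (le_trans (ltW ct) tT).
Qed.

Lemma mean_value_le u s t (c e : R) : is_C1 u ->
  (forall r, `|segval r - segval s| <= `|segval t - segval s| -> `|dseg u r - c| <= e) ->
  `|u t - u s - c * (segval t - segval s)| <= e * `|segval t - segval s|.
Proof.
move=> cu h; have [st|ts|/(@segval_inj R T)->] := ltgtP (segval s) (segval t).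
- have [r [/andP[sr rt] ->]] := mean_value cu st.
  rewrite -mulrBl normrM ler_wpM2r//; apply: h.
  by rewrite !gtr0_norm ?subr_gt0//; lra.
- have [r [/andP[tr rs] e1]] := mean_value cu ts.
  rewrite -[u t - _]opprB e1 -mulrN opprB -mulrBl normrM ler_wpM2r//; apply: h.
  by rewrite !ltr0_norm ?subr_lt0//; lra.
- by rewrite !subrr mulr0 subr0 normr0 mulr0.
Qed.

Lemma integral_dseg u : is_C1 u ->
  \int[lebesgue_measure]_(x in `[0, T%:num]) dseg u (projseg x) = u (segT T) - u (seg0 T).
Proof.
move=> cu; have T0 : 0 < T%:num :> R by [].
have cpu : continuous (u \o projseg) by apply: continuous_projseg; exact: is_C1_continuous.
have [_ cd] := cu.
have := @continuous_FTC2 R (dseg u \o projseg) (u \o projseg) 0 T%:num T0 _ _ _.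
rewrite /Rintegral => ->.
- have eT : projseg T%:num = segT T := projsegK (segT T).
  have e0 : projseg 0 = seg0 T := projsegK (seg0 T).
  by rewrite /= eT e0.
- by apply: continuous_subspaceT; exact: continuous_projseg.
- split.
  + move=> x; rewrite in_itv/= => /(is_derive_projseg cu) h; exact: ex_derive.
  + by apply: cvg_at_right_filter; exact: cpu.
  + by apply: cvg_at_left_filter; exact: cpu.
- move=> x; rewrite in_itv/= => /(is_derive_projseg cu) h.
  by rewrite derive1E; exact: derive_val.
Qed.

End segment.

(** * Compactness in C1 *)

Lemma fmap_ultra {I U : Type} (f : I -> U) (F : set_system I) :
  UltraFilter F -> UltraFilter (f @ F).
Proof.
move=> UF; apply: Build_UltraFilter => G PG FG; apply/seteqP; split => // A GA.
have [//|FA] := in_ultra_setVsetC (f @^-1` A) UF.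
have /FG nA : (f @ F) (~` A) by [].
have G0 : G (A `&` ~` A) by exact: filterI.
by have := @filter_not_empty _ G _; rewrite -(setICr A) => /(_ PG G0).
Qed.

Section compactness.
Context {R : realType} {I : Type} (F : set_system I) {UF : UltraFilter F}.

#[local] Instance ultra_proper_filter : ProperFilter F := ultra_proper.

(** Along an ultrafilter, compactness yields a limit without extracting subsequences, so limits can
    be taken at all points of the segment at once. *)
Lemma ultra_bounded_cvg (x : I -> R) (B : R) :
  (\forall i \near F, `|x i| <= B) -> exists l : R, x i @[i --> F] --> l.
Proof.
move=> xB; have := @segment_compact R (- B) B.
rewrite compact_ultra => /(_ (x @ F) (fmap_ultra x UF)) [|l [_ xl]]; last by exists l.
by apply: filterS xB => i; rewrite /= in_itv/= ler_norml.
Qed.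

Lemma cvg_le_norm (x y : I -> R) (a b e : R) : x i @[i --> F] --> a -> y i @[i --> F] --> b ->
  (\forall i \near F, `|x i - y i| <= e) -> `|a - b| <= e.
Proof.
move=> xa yb xye; have h : `|x i - y i| @[i --> F] --> `|a - b| by exact: (cvg_norm (cvgB xa yb)).
exact: (cvgr_to_le h xye).
Qed.

Context (T : {posnum R}).

(** The set of indices may depend on [e]: for Euler polygons the mesh is first made small compared
    with [d]. *)
Definition equicontinuous_along (g : I -> seg T -> R) :=
  forall e : R, 0 < e -> exists2 d : R, 0 < d &
    \forall i \near F, forall s t : seg T, `|segval s - segval t| < d -> `|g i s - g i t| <= e.

Lemma equicontinuous_limit (g : I -> seg T -> R) (w : seg T -> R) :
  (forall t, g i t @[i --> F] --> w t) -> equicontinuous_along g ->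
  forall e : R, 0 < e -> exists2 d : R, 0 < d &
    forall s t : seg T, `|segval s - segval t| < d -> `|w s - w t| <= e.
Proof.
move=> gw eg e e0; have [d d0 dP] := eg e e0; exists d => // s t st.
by apply: (cvg_le_norm (gw s) (gw t)); apply: filterS dP => i; exact.
Qed.

(** Pointwise convergence at [x] and equicontinuity give the bound near [x] by three errors [e / 3];
    compactness of the segment makes it uniform. *)
Lemma equicontinuous_uniform (g : I -> seg T -> R) (w : seg T -> R) :
  (forall t, g i t @[i --> F] --> w t) -> equicontinuous_along g ->
  forall e : R, 0 < e -> \forall i \near F, forall t, `|g i t - w t| <= e.
Proof.
move=> gw eg e e0; have e30 : 0 < e / 3 by rewrite divr_gt0.
have [d d0 dP] := eg _ e30; have [d' d'0 dP'] := equicontinuous_limit gw eg e30.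
have := @segment_compact R 0 T%:num; rewrite compact_near_coveringP.
move=> /(_ I F (fun i x => `|g i (projseg T x) - w (projseg T x)| <= e) _).
have h : forall x : R, `[0, T%:num]%classic x -> \near x & F,
    `|g F (projseg T x) - w (projseg T x)| <= e.
  move=> x _; have /cvgrPdist_le/(_ _ e30) gx := gw (projseg T x).
  exists (ball x (Num.min d d'), [set i | `|w (projseg T x) - g i (projseg T x)| <= e / 3 /\
     forall s t : seg T, `|segval s - segval t| < d -> `|g i s - g i t| <= e / 3]).
    by split; [apply: nbhsx_ballx; rewrite lt_min d0|exact: filterI].
  move=> [y i] /= [xy [h1 h2]].
  have : `|segval (projseg T x) - segval (projseg T y)| < Num.min d d'.
    by apply: le_lt_trans (clamp_dist T x y) _; exact: xy.
  rewrite lt_min => /andP[/h2 {}h2 /dP' h3].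
  rewrite (_ : _ - _ = (g i (projseg T y) - g i (projseg T x)) +
    (g i (projseg T x) - w (projseg T x)) + (w (projseg T x) - w (projseg T y))); last by ring.
  apply: (le_trans (ler_normD _ _)); rewrite distrC in h1; rewrite distrC in h2.
  have := ler_normD (g i (projseg T y) - g i (projseg T x)) (g i (projseg T x) - w (projseg T x)).
  lra.
move=> /(_ h); apply: filterS => i hi t.
by have := hi (segval t) (segval_itv t); rewrite projsegK.
Qed.

Lemma C1_norm_dseg (u : C1 T) t : `|dseg u t| <= `|u|.
Proof.
have [_ cd] := C1P u; apply: (le_trans (supnorm_ub t cd)).
by rewrite C1_normE lerDr supnorm_ge0//; exact/is_C1_continuous/C1P.
Qed.

Lemma C1_norm_val (u : C1 T) t : `|u t| <= `|u|.
Proof.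
have [_ cd] := C1P u; apply: (le_trans (supnorm_ub t (is_C1_continuous (C1P u)))).
by rewrite C1_normE lerDl supnorm_ge0.
Qed.

Lemma C1_norm_le (u : C1 T) (a b : R) : (forall t, `|u t| <= a) ->
  (forall t, `|dseg u t| <= b) -> `|u| <= a + b.
Proof. by move=> ua ub; rewrite C1_normE lerD//; exact: supnorm_le. Qed.

Lemma C1_lipschitz (u : C1 T) s t : `|u s - u t| <= `|u| * `|segval s - segval t|.
Proof.
have := @mean_value_le R T u t s 0 `|u| (C1P u).
by rewrite mul0r subr0; apply => r _; rewrite subr0 C1_norm_dseg.
Qed.

Lemma dsegB (u v : C1 T) t : dseg (u - v) t = dseg u t - dseg v t.
Proof.
have -> : (u - v : C1 T) = (u + (-1) *: v :> C1 T) by rewrite scaleN1r.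
rewrite [dseg _](dsegD (C1P u) (C1P ((-1) *: v))) /= [dseg ((-1) *: v)](dsegZ (-1) (C1P v)).
by rewrite mulN1r.
Qed.

(** Ascoli's theorem in C1. The functions and their derivatives have pointwise limits [u] and [w];
    equicontinuity makes both convergences uniform, and the mean value estimates pass to the limit
    to show that [w] is the derivative of [u]. *)
Lemma C1_ultra_cvg (u_ : I -> C1 T) (B : R) : (\forall i \near F, `|u_ i| <= B) ->
  equicontinuous_along (fun i => dseg (u_ i)) -> exists u : C1 T, u_ i @[i --> F] --> u.
Proof.
move=> uB ew.
have cu t : exists l : R, u_ i t @[i --> F] --> l.
  by apply: (@ultra_bounded_cvg _ B); apply: filterS uB => i; exact: le_trans (C1_norm_val _ _).
have cw t : exists l : R, dseg (u_ i) t @[i --> F] --> l.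
  by apply: (@ultra_bounded_cvg _ B); apply: filterS uB => i; exact: le_trans (C1_norm_dseg _ _).
have [u {}cu] := choice cu; have [w {}cw] := choice cw.
have eu : equicontinuous_along (fun i => u_ i : seg T -> R).
  move=> e e0; exists (e / (`|B| + 1)); first by rewrite divr_gt0// ltr_wpDl.
  apply: filterS uB => i uB s t; rewrite ltr_pdivlMr ?ltr_wpDl// => st.
  apply: (le_trans (C1_lipschitz _ _ _)); apply: le_trans (ltW st).
  rewrite mulrC ler_wpM2l//; have := ler_norm B; lra.
have [Cu du] : is_C1 u /\ dseg u = w.
  apply: is_C1_of_derivative.
    apply/continuous_segP => t e e0.
    have [d d0 dP] := equicontinuous_limit cw ew (divr_gt0 e0 (ltr0n _ 2)).
    by exists d => // s st; apply: (le_lt_trans (dP t s st)); lra.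
  move=> t e e0; have [d d0 dP] := ew e e0; exists d => // s ts.
  apply: (@cvg_le_norm (fun i => u_ i s - u_ i t) (fun i => dseg (u_ i) t * (segval s - segval t))).
  - by apply: cvgB.
  - by apply: cvgM => //; exact: cvg_cst.
  - apply: filterS dP => i h; apply: mean_value_le; first exact: C1P.
    by move=> r rs; apply: h; apply: (le_lt_trans rs); rewrite distrC.
pose U : C1 T := MkC1 (asboolT Cu).
exists U; apply/cvgrPdist_le => e e0.
have e20 : 0 < e / 2 by rewrite divr_gt0.
have h1 := equicontinuous_uniform cu eu e20.
have h2 := equicontinuous_uniform cw ew e20.
apply: filterS2 h1 h2 => i h1 h2; rewrite distrC [e]splitr; apply: C1_norm_le => t; first exact: h1.
by rewrite dsegB du; exact: h2.
Qed.

End compactness.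

(** * The map G on C1 *)

Section nemytskii.
Context {R : realType} (T : {posnum R}) (f : R * R * R -> R).
Context (f_cont : {within strip T, continuous f}).

(** [f] is continuous only within the strip; clamping the time gives a function that is continuous
    everywhere and agrees with [f] on the strip. *)
Definition fclamp (p : R * R * R) : R := f (clamp T p.1.1, p.1.2, p.2).

Lemma clamp_continuous : continuous (clamp T).
Proof.
move=> x; apply/cvgrPdist_lt => e e0; apply/nbhs_ballP; exists e => //= y xy.
exact: le_lt_trans (clamp_dist T x y) xy.
Qed.

Lemma fclamp_continuous : continuous fclamp.
Proof.
move=> [[x y] z].
have c1 : (clamp T p.1.1, p.1.2, p.2) @[p --> (x, y, z)] --> (clamp T x, y, z).
  have c11 : (p : R * R * R).1 @[p --> (x, y, z)] --> (x, y) by exact: cvg_fst.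
  have cA : p.1.1 @[p --> (x, y, z)] --> x by apply: (cvg_comp _ _ c11); exact: cvg_fst.
  have cB : p.1.2 @[p --> (x, y, z)] --> y by apply: (cvg_comp _ _ c11); exact: cvg_snd.
  have cC : p.2 @[p --> (x, y, z)] --> z by exact: cvg_snd.
  have cA' : clamp T p.1.1 @[p --> (x, y, z)] --> clamp T x.
    by apply: (cvg_comp _ _ cA); exact: clamp_continuous.
  exact: (cvg_pair (cvg_pair cA' cB) cC).
have := f_cont; rewrite subspace_continuousP => /(_ (clamp T x, y, z)).
rewrite {1}/strip /= clamp_itv => /(_ isT) fc A hA.
have h : \forall q \near (clamp T x, y, z), strip T q -> A (f q) := fc A hA.
have h' : \forall p \near (x, y, z), strip T (clamp T p.1.1, p.1.2, p.2) -> A (fclamp p) := c1 _ h.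
rewrite /nbhs/=; apply: (@filterS _ _ _ _ _ _ h') => p hp.
by apply: hp; rewrite /strip/= clamp_itv.
Qed.

Lemma fclampE p : strip T p -> fclamp p = f p.
Proof. by case: p => [[x y] z] /= h; rewrite /fclamp/= clamp_id. Qed.

Definition nemytskii (u : C1 T) (t : seg T) : R := fclamp (segval t, u t, dseg u t).

Lemma C1_near (u : C1 T) (e : R) : 0 < e ->
  \forall v \near u, forall t, `|(v : C1 T) t - u t| <= e /\ `|dseg v t - dseg u t| <= e.
Proof.
move=> e0; apply/nbhs_ballP; exists e => //= v; rewrite -ball_normE /ball_/= distrC => uv t.
split; last by rewrite -dsegB; exact: le_trans (C1_norm_dseg _ _) (ltW uv).
exact: le_trans (C1_norm_val (v - u) t) (ltW uv).
Qed.

(** Continuity jointly in the function and the point, which compactness of the segment turns into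
    uniform closeness and which later controls the increments of polygons tending to [u]. *)
Lemma nemytskii_continuous (u : C1 T) (t : seg T) (e : R) : 0 < e ->
  exists2 d : R, 0 < d & \forall v \near u, forall s, `|segval t - segval s| < d ->
    `|nemytskii v s - nemytskii u t| <= e.
Proof.
move=> e0; have [_ cd] := C1P u.
have /cvgrPdist_le/(_ e e0) := @fclamp_continuous (segval t, u t, dseg u t).
move=> /nbhs_ballP[r /= r0 rP].
have r20 : 0 < r / 2 by rewrite divr_gt0.
have /continuous_segP/(_ t _ r20)[d1 d10 d1P] := is_C1_continuous (C1P u).
have /continuous_segP/(_ t _ r20)[d2 d20 d2P] := cd.
exists (Num.min r (Num.min d1 d2)); first by rewrite !lt_min r0 d10.
have r30 : 0 < r / 3 by rewrite divr_gt0.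
have := C1_near u r30; apply: filterS => v vu s; rewrite !lt_min => /and3P[tr t1 t2].
rewrite distrC; have [v1 v2] := vu s; rewrite distrC in v1; rewrite distrC in v2.
apply: rP; split; [split => //|] => /=.
  have := d1P s t1; have := ler_distD (u s) (u t) (v s); rewrite /ball/=; lra.
have := d2P s t2; have := ler_distD (dseg u s) (dseg u t) (dseg v s); rewrite /ball/=; lra.
Qed.

Lemma nemytskii_continuous_seg (u : C1 T) : continuous (nemytskii u).
Proof.
apply/continuous_segP => t e e0; have e20 : 0 < e / 2 by rewrite divr_gt0.
have [d d0 /nbhs_singleton dP] := nemytskii_continuous u t e20; exists d => // s ts.
by rewrite distrC; apply: (le_lt_trans (dP s ts)); lra.
Qed.

Lemma nemytskii_uniform (u : C1 T) (e : R) : 0 < e ->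
  \forall v \near u, forall t, `|nemytskii v t - nemytskii u t| <= e.
Proof.
move=> e0; have e20 : 0 < e / 2 by rewrite divr_gt0.
have := @segment_compact R 0 T%:num; rewrite compact_near_coveringP.
move=> /(_ _ (nbhs u) (fun v x => `|nemytskii v (projseg T x) - nemytskii u (projseg T x)| <= e) _).
have h : forall x : R, `[0, T%:num]%classic x -> \forall y \near x & v \near u,
    `|nemytskii v (projseg T y) - nemytskii u (projseg T y)| <= e.
  move=> x _; have [d d0 dP] := nemytskii_continuous u (projseg T x) e20.
  exists (ball x d, [set v | forall s, `|segval (projseg T x) - segval s| < d ->
     `|nemytskii v s - nemytskii u (projseg T x)| <= e / 2]).
    by split => //; exact: nbhsx_ballx.
  move=> [y v] /= [xy vP].
  have xy' : `|segval (projseg T x) - segval (projseg T y)| < d.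
    by apply: le_lt_trans (clamp_dist T x y) _; exact: xy.
  have h1 := vP _ xy'; have h2 := nbhs_singleton dP _ xy'.
  have := ler_distD (nemytskii u (projseg T x)) (nemytskii v (projseg T y)) (nemytskii u (projseg T y)).
  rewrite distrC in h2; lra.
move=> /(_ h); apply: filterS => v hv t.
by have := hv (segval t) (segval_itv t); rewrite projsegK.
Qed.

Lemma Rintegral_close (g1 g2 : R -> R) (e : R) : continuous g1 -> continuous g2 ->
  (forall x, `|g1 x - g2 x| <= e) ->
  `|\int[lebesgue_measure]_(x in `[0, T%:num]) g1 x -
    \int[lebesgue_measure]_(x in `[0, T%:num]) g2 x| <= e * T%:num.
Proof.
move=> c1 c2 g12.
have int (g : R -> R) : continuous g -> lebesgue_measure.-integrable `[0, T%:num] (EFin \o g).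
  move=> cg; apply: continuous_compact_integrable; first exact: segment_compact.
  exact: continuous_subspaceT.
have cB : continuous (fun x => g1 x - g2 x) by move=> x; apply: cvgB; [exact: c1|exact: c2].
rewrite -RintegralB//; [|exact: int|exact: int].
apply: (le_trans (le_normr_Rintegral _ _)) => //; first exact: int.
apply: (@le_trans _ _ (\int[lebesgue_measure]_(x in `[0, T%:num]) e)).
  apply: le_Rintegral => //; apply: int; last by move=> x; exact: cvg_cst.
  by move=> x; apply: cvg_norm; exact: cB.
rewrite Rintegral_cst//.
have := lebesgue_measure_itv `[0 : R, T%:num]; rewrite /= lte_fin (_ : 0 < T%:num)// => mT.
by rewrite [X in fine X](_ : _ = T%:num%:E)//; apply: (eq_trans mT); rewrite -EFinB subr0.
Qed.

(** In the formula of G, [a + b T] is read as [u(T)] and [b] as [u'(0)]; the terms outside the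
    integral in the first coordinate then combine to [T (u(T) - u'(0))]. *)
Definition Gseg (u : C1 T) : 'rV[R]_2 :=
  vec (T%:num * (u (segT T) - dseg u (seg0 T)) - T%:num^-1 *
        \int[lebesgue_measure]_(x in `[0, T%:num]) nemytskii u (projseg T x))
      (dseg u (seg0 T) - u (segT T)).

Lemma dseg_affine (v : 'rV[R]_2) t : dseg (affineC1 T v) t = v 0 1.
Proof.
apply: dseg_eq; apply/cvg_diffquotP => e e0; exists 1 => // s _ /=.
by rewrite opprD addrACA subrr add0r -mulrBr subrr normr0 mulr_ge0// ltW.
Qed.

Lemma Gseg_affine v : Gseg (affineC1 T v) = Gmap T f v.
Proof.
apply/rowP => j; rewrite !mxE; case: ifP => _; rewrite dseg_affine/=.
  rewrite (_ : segval (segT T) = T%:num)//; congr (_ - _ * _); first by ring.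
  apply: eq_Rintegral => x /set_mem /=; rewrite in_itv/= => xT.
  rewrite /nemytskii dseg_affine fclampE/=; last by rewrite /strip/= clamp_itv.
  by rewrite segval_projseg clamp_id.
by rewrite (_ : segval (segT T) = T%:num)//; ring.
Qed.

Lemma Gseg_continuous : continuous Gseg.
Proof.
move=> u.
have cT : (v : C1 T) (segT T) @[v --> u] --> u (segT T).
  apply/(cvgrPdist_le (FF := nbhs_filter u)) => e e0; have := C1_near u e0.
  by apply: filterS => v /(_ (segT T))[]; rewrite distrC.
have c0 : dseg v (seg0 T) @[v --> u] --> dseg u (seg0 T).
  apply/(cvgrPdist_le (FF := nbhs_filter u)) => e e0; have := C1_near u e0.
  by apply: filterS => v /(_ (seg0 T))[_]; rewrite distrC.
have cI : \int[lebesgue_measure]_(x in `[0, T%:num]) nemytskii v (projseg T x) @[v --> u] -->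
    \int[lebesgue_measure]_(x in `[0, T%:num]) nemytskii u (projseg T x).
  apply/(cvgrPdist_le (FF := nbhs_filter u)) => e e0; have eT : 0 < e / T%:num by rewrite divr_gt0.
  have := nemytskii_uniform u eT; apply: filterS => v uv.
  rewrite -[leRHS](@divfK _ T%:num)//.
  apply: Rintegral_close => [||x]; last by rewrite distrC.
    exact/continuous_projseg/nemytskii_continuous_seg.
  exact/continuous_projseg/nemytskii_continuous_seg.
apply: continuous_rV2 => j; rewrite !mxE.
under eq_cvg do rewrite mxE.
case: ifP => _; last exact: (cvgB (FF := nbhs_filter u) c0 cT).
apply: (cvgB (FF := nbhs_filter u)).
  exact: (cvgMl_tmp (FF := nbhs_filter u) (cvgB (FF := nbhs_filter u) cT c0)).
exact: (cvgMl_tmp (FF := nbhs_filter u) cI).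
Qed.

End nemytskii.

(** * Euler polygons *)

Section euler.
Context {R : realType} (T : {posnum R}).

Lemma ramp_quadratic (c x y : R) :
  `|Num.max (y - c) 0 ^+ 2 / 2 - Num.max (x - c) 0 ^+ 2 / 2 - Num.max (x - c) 0 * (y - x)|
    <= 1 * (y - x) ^+ 2.
Proof.
rewrite mul1r (_ : y - x = (y - c) - (x - c)); last by ring.
move: (y - c) (x - c) => a b.
have := (sqr_ge0 (a - b), sqr_ge0 a, sqr_ge0 b); rewrite !expr2 => -[[h1 h2] h3].
rewrite ler_norml; case: (lerP a 0) => ha; case: (lerP b 0) => hb; apply/andP; split.
- lra.
- lra.
- nra.
- nra.
- nra.
- nra.
- nra.
- nra.
Qed.

(** Half the squared positive part of [t - c]: a C1 function whose derivative is the positive part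
    itself. *)
Definition ramp (c : R) : C1 T := MkC1 (asboolT (is_C1_quadratic T (ramp_quadratic c)).1).

Lemma dseg_ramp c t : dseg (ramp c) t = Num.max (segval t - c) 0.
Proof. by rewrite /= (is_C1_quadratic T (ramp_quadratic c)).2. Qed.

(** Its slope rises linearly from 0 before [c] to 1 after [d]. Adding a multiple changes the slope
    across one cell and stays within C1. *)
Definition slope_step (c d : R) : C1 T := (d - c)^-1 *: (ramp c - ramp d).

Lemma dsegZE (a : R) (u : C1 T) t : dseg (a *: u) t = a * dseg u t.
Proof. by rewrite [dseg _](dsegZ a (C1P u)). Qed.

Lemma dsegDE (u v : C1 T) t : dseg (u + v) t = dseg u t + dseg v t.
Proof. by rewrite [dseg _](dsegD (C1P u) (C1P v)). Qed.

Lemma dseg_slope_step c d t : dseg (slope_step c d) t =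
  (Num.max (segval t - c) 0 - Num.max (segval t - d) 0) / (d - c).
Proof. by rewrite dsegZE dsegB !dseg_ramp mulrC. Qed.

Lemma slope_step_before c d t : c < d -> segval t <= c ->
  slope_step c d t = 0 /\ dseg (slope_step c d) t = 0.
Proof.
move=> cd tc; rewrite dseg_slope_step max_r ?max_r ?subrr ?mul0r ?subr_le0//; last first.
  exact: le_trans (ltW cd).
split => //; rewrite /slope_step -[LHS]/((d - c)^-1 *
  (Num.max (segval t - c) 0 ^+ 2 / 2 - Num.max (segval t - d) 0 ^+ 2 / 2)).
by rewrite max_r ?max_r ?subrr ?mulr0 ?subr_le0//; exact: le_trans (ltW cd).
Qed.

Lemma slope_step_after c d t : c < d -> d <= segval t -> dseg (slope_step c d) t = 1.
Proof.
move=> cd dt; rewrite dseg_slope_step !max_l ?subr_ge0//; last exact: le_trans (ltW cd) dt.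
rewrite (_ : segval t - c - _ = d - c); last by ring.
by rewrite divff// subr_eq0 gt_eqF.
Qed.

Lemma slope_step_between c d t : c < d -> c <= segval t <= d ->
  0 <= dseg (slope_step c d) t <= 1.
Proof.
move=> cd /andP[ct td]; rewrite dseg_slope_step max_l ?subr_ge0// max_r ?subr_le0//.
have dc : 0 < d - c by rewrite subr_gt0.
by rewrite subr0 divr_ge0 ?subr_ge0 ?(ltW cd)//= ler_pdivrMr// mul1r lerD2r.
Qed.

Definition knot (N k : nat) : R := T%:num * k%:R / N.+1%:R.

Lemma knot0 N : knot N 0 = 0. Proof. by rewrite /knot mulr0 mul0r. Qed.

Lemma knotT N : knot N N.+1 = T%:num. Proof. by rewrite /knot mulfK. Qed.

Lemma knotS N k : knot N k.+1 = knot N k + T%:num / N.+1%:R.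
Proof. by rewrite /knot -natr1 mulrDr mulr1 mulrDl. Qed.

Lemma knot_le N j k : (knot N j <= knot N k) = (j <= k)%N.
Proof.
have N0 : 0 < (N.+1%:R : R)^-1 by rewrite invr_gt0.
by rewrite /knot (ler_pM2r N0) ler_pM2l// ler_nat.
Qed.

Lemma knot_lt N j k : (knot N j < knot N k) = (j < k)%N.
Proof. by rewrite ltNge knot_le -ltnNge. Qed.

Lemma knot_itv N k : (k <= N.+1)%N -> 0 <= knot N k <= T%:num.
Proof. by move=> kN; rewrite -{1}(knot0 N) -(knotT N) !knot_le. Qed.

Lemma segval_knot N k : (k <= N.+1)%N -> segval (projseg T (knot N k)) = knot N k.
Proof. by move=> kN; rewrite segval_projseg clamp_id// knot_itv. Qed.

Lemma knot_cell N (t : seg T) : exists2 k, (k <= N)%N & knot N k <= segval t <= knot N k.+1.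
Proof.
have [t0 tT] := andP (segval_itv t).
suff h k : (k <= N)%N -> segval t <= knot N k.+1 ->
    exists2 j, (j <= N)%N & knot N j <= segval t <= knot N j.+1.
  by apply: (h N (leqnn N)); rewrite knotT.
elim: k => [|k IH] kN tk; first by exists 0%N => //; rewrite knot0 t0.
have [tk'|tk'] := leP (segval t) (knot N k.+1); first exact: IH (ltnW kN) tk'.
by exists k.+1; rewrite // (ltW tk').
Qed.

(** * The Euler scheme for the equation *)

Context (f : R * R * R -> R) (phi psi : R -> R).
Context (f_cont : {within strip T, continuous f}) (phi_cont : continuous phi)
  (psi_cont : continuous psi) (phiK : cancel phi psi).

(* The state after [k] steps: the function built so far, affine after the k-th
   knot, together with the current value of [phi u'] *)
Fixpoint euler (N : nat) (lam : R) (x : 'rV[R]_2) (k : nat) : C1 T * R :=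
  if k is k'.+1 then
    let: (u, v) := euler N lam x k' in
    let v' := v + lam * (T%:num / N.+1%:R) * nemytskii f u (projseg T (knot N k')) in
    (u + (psi v' - psi v) *: slope_step (knot N k') (knot N k'.+1), v')
  else (affineC1 T x, phi (x 0 1)).

(** It is the derivative that is polygonal: it interpolates linearly between the slopes [psi v] at
    the knots. *)
Definition polygon N lam x : C1 T := (euler N lam x N.+1).1.

Lemma euler2S N lam x k : (euler N lam x k.+1).2 = (euler N lam x k).2 +
  lam * (T%:num / N.+1%:R) * nemytskii f (euler N lam x k).1 (projseg T (knot N k)).
Proof. by rewrite /=; case: (euler N lam x k). Qed.

Lemma euler1S N lam x k : (euler N lam x k.+1).1 = (euler N lam x k).1 +
  (psi (euler N lam x k.+1).2 - psi (euler N lam x k).2) *: slope_step (knot N k) (knot N k.+1).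
Proof. by rewrite /=; case: (euler N lam x k). Qed.

Section spec.
Context (N : nat) (lam : R) (x : 'rV[R]_2).
Let u_ k := (euler N lam x k).1.
Let v_ k := (euler N lam x k).2.

Let vS k : v_ k.+1 = v_ k + lam * (T%:num / N.+1%:R) * nemytskii f (u_ k) (projseg T (knot N k)).
Proof. exact: euler2S. Qed.

Let uS k : u_ k.+1 = u_ k + (psi (v_ k.+1) - psi (v_ k)) *: slope_step (knot N k) (knot N k.+1).
Proof. exact: euler1S. Qed.

Let uSE k t : u_ k.+1 t = u_ k t + (psi (v_ k.+1) - psi (v_ k)) * slope_step (knot N k) (knot N k.+1) t.
Proof. by rewrite uS. Qed.

Let duS k t : dseg (u_ k.+1) t =
  dseg (u_ k) t + (psi (v_ k.+1) - psi (v_ k)) * dseg (slope_step (knot N k) (knot N k.+1)) t.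
Proof. by rewrite uS dsegDE dsegZE. Qed.

Let du_after k t : knot N k <= segval t -> dseg (u_ k) t = psi (v_ k).
Proof.
elim: k t => [|k IH] t kt; first by rewrite /u_ /v_/= dseg_affine phiK.
have kk : knot N k < knot N k.+1 by rewrite knot_lt.
by rewrite duS slope_step_after// IH ?(le_trans (ltW kk))//; ring.
Qed.

(** Causality of the scheme: the step taken at a knot changes the function only after that knot. *)
Let u_before k j t : segval t <= knot N k -> (k <= j)%N ->
  u_ j t = u_ k t /\ dseg (u_ j) t = dseg (u_ k) t.
Proof.
move=> tk; elim: j => [|j IH]; first by rewrite leqn0 => /eqP ->.
rewrite leq_eqVlt => /orP[/eqP->//|]; rewrite ltnS => kj.
have [<- <-] := IH kj; rewrite uSE duS.
have [||-> ->] := @slope_step_before (knot N j) (knot N j.+1) t; first by rewrite knot_lt.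
  by apply: (le_trans tk); rewrite knot_le.
by rewrite mulr0 !addr0.
Qed.

(** Since values and slopes up to a knot are final once it is reached, the recursion can be stated
    with the completed polygon instead of the partial ones. It becomes a discrete form of the
    equation. *)
Lemma polygon_spec : exists v : nat -> R,
  [/\ v 0%N = phi (x 0 1),
      forall k, (k <= N)%N -> v k.+1 = v k + lam * (T%:num / N.+1%:R) *
        nemytskii f (polygon N lam x) (projseg T (knot N k)),
      forall k, (k <= N.+1)%N -> dseg (polygon N lam x) (projseg T (knot N k)) = psi (v k) &
      forall k t, (k <= N)%N -> knot N k <= segval t <= knot N k.+1 ->
        exists2 th : R, 0 <= th <= 1 &
          dseg (polygon N lam x) t = psi (v k) + th * (psi (v k.+1) - psi (v k))].
Proof.
exists v_; split => [//|k kN|k kN|k t kN /andP[kt tk]].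
- have [||e1 e2] := @u_before k N.+1 (projseg T (knot N k)); rewrite ?segval_knot//; try exact: leqW.
  by rewrite vS /nemytskii -/(u_ N.+1) /polygon -/(u_ N.+1) e1 e2.
- have [||_ ->] := @u_before k N.+1 (projseg T (knot N k)); rewrite ?segval_knot//.
  by rewrite du_after// segval_knot.
- have [||_ ->] := @u_before k.+1 N.+1 t => //.
  exists (dseg (slope_step (knot N k) (knot N k.+1)) t).
    by apply: slope_step_between; rewrite ?knot_lt// kt.
  by rewrite duS du_after// mulrC.
Qed.

Lemma polygon_initial : polygon N lam x (seg0 T) = x 0 0 /\ dseg (polygon N lam x) (seg0 T) = x 0 1.
Proof.
have [||e1 e2] := @u_before 0%N N.+1 (seg0 T); rewrite ?knot0//.
rewrite /polygon -/(u_ N.+1) e1 e2 /u_/= dseg_affine; split => //.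
by rewrite (_ : segval (seg0 T) = 0)// mulr0 addr0.
Qed.

End spec.

Lemma polygon0 N x : polygon N 0 x = affineC1 T x.
Proof.
have h k : euler N 0 x k = (affineC1 T x, phi (x 0 1)).
  by elim: k => //= k ->; rewrite !mul0r addr0 subrr scale0r addr0.
by rewrite /polygon h.
Qed.

(** A combination of two fixed elements of C1 with continuous coefficients: the form from which
    continuity in the initial data is read off. *)
Lemma affineC1E (v : 'rV[R]_2) :
  affineC1 T v = v 0 0 *: affineC1 T (vec 1 0) + v 0 1 *: affineC1 T (vec 0 1) :> C1 T.
Proof.
apply: val_inj; apply/funext => t.
rewrite -[RHS]/(v 0 0 * (vec 1 0 0 0 + vec 1 0 0 1 * segval t) +
  v 0 1 * (vec 0 1 0 0 + vec 0 1 0 1 * segval t)).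
by rewrite !mxE/=; ring.
Qed.

Lemma nemytskii_cvg (u : C1 T) t : nemytskii f v t @[v --> u] --> nemytskii f u t.
Proof.
apply/(cvgrPdist_le (FF := nbhs_filter u)) => e e0.
have [d d0 dP] := nemytskii_continuous f_cont u t e0.
by apply: filterS dP => v /(_ t); rewrite subrr normr0 distrC; apply.
Qed.

Lemma polygon_continuous N : continuous (fun p : R * 'rV[R]_2 => polygon N p.1 p.2).
Proof.
move=> p0.
have c2 j : (p : R * 'rV[R]_2).2 0 j @[p --> p0] --> p0.2 0 j.
  by apply: coord_cvg => /=; exact: cvg_snd.
have c1 : (p : R * 'rV[R]_2).1 @[p --> p0] --> p0.1 by exact: cvg_fst.
suff h k : (euler N (p : R * 'rV[R]_2).1 p.2 k).1 @[p --> p0] --> (euler N p0.1 p0.2 k).1 /\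
    (euler N (p : R * 'rV[R]_2).1 p.2 k).2 @[p --> p0] --> (euler N p0.1 p0.2 k).2.
  by have [] := h N.+1.
elim: k => [|k [IH1 IH2]].
  split; last by exact: (cvg_comp _ phi (c2 1) (@phi_cont _)).
  rewrite /= affineC1E; under eq_cvg do rewrite affineC1E.
  by apply: cvgD; apply: cvgZ; try exact: c2; exact: cvg_cst.
have h2 : (euler N (p : R * 'rV[R]_2).1 p.2 k.+1).2 @[p --> p0] --> (euler N p0.1 p0.2 k.+1).2.
  rewrite euler2S; under eq_cvg do rewrite euler2S.
  apply: cvgD => //; apply: cvgM; first by apply: cvgM => //; exact: cvg_cst.
  exact: (cvg_comp _ (fun u : C1 T => nemytskii f u (projseg T (knot N k))) IH1 (@nemytskii_cvg _ _)).
split => //; rewrite euler1S; under eq_cvg do rewrite euler1S.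
apply: cvgD => //; apply: cvgZ; last exact: cvg_cst.
exact: (cvgB (cvg_comp _ psi h2 (@psi_cont _)) (cvg_comp _ psi IH2 (@psi_cont _))).
Qed.

End euler.

(** * Limits of Euler polygons *)

Section limit.
Context {R : realType} (T : {posnum R}).

Lemma bounded_on_compact {X : topologicalType} (K : set X) (g : X -> R) :
  compact K -> continuous g -> exists2 C : R, 0 <= C & forall x, K x -> `|g x| <= C.
Proof.
move=> cK cg; have := @continuous_compact _ _ g K (continuous_subspaceT cg) cK.
move=> /compact_bounded[M [_ hM]]; exists (`|M| + 1); first by rewrite addr_ge0.
move=> x Kx; apply: (hM (`|M| + 1)); last by exists x.
by have := ler_norm M; lra.
Qed.

(** A Lebesgue number for the sets on which [g] oscillates by at most [e]; only [y] has to lie in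
    the segment. *)
Lemma uniform_on_segment (g : R -> R) (V e : R) : continuous g -> 0 < e ->
  exists2 d : R, 0 < d & forall y z, `|y| <= V -> `|y - z| < d -> `|g y - g z| <= e.
Proof.
move=> cg e0; have e20 : 0 < e / 2 by rewrite divr_gt0.
have [|||d d0 dP] := @lebesgue_number R R [set` `[- V, V]]
    (fun A => forall y z, A y -> A z -> `|g y - g z| <= e).
- exact: segment_compact.
- by move=> A B AB gB y z /AB By /AB; exact: gB.
- move=> z _; have /cvgrPdist_le/(_ _ e20) h := cg z.
  exists [set y | `|g z - g y| <= e / 2] => // x y /= h1 h2.
  have := ler_distD (g z) (g x) (g y); rewrite [`|g x - g z|]distrC; lra.
exists d => // y z yV yz; apply: (dP y) => //; last exact: ballxx.
by rewrite /= in_itv/= -ler_norml.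
Qed.

(** The mean value estimate for the scheme, obtained by summing the steps. With [c = 0] it gives
    Lipschitz bounds; with [c] the limiting right-hand side it gives the derivative of [phi u']. *)
Lemma discrete_increment (N : nat) (lam : R) (v y : nat -> R) (c e : R) (j k : nat) :
  0 <= lam <= 1 -> (forall i, (i <= N)%N -> v i.+1 = v i + lam * (T%:num / N.+1%:R) * y i) ->
  (j <= k <= N.+1)%N -> (forall i, (j <= i < k)%N -> `|y i - c| <= e) ->
  `|v k - v j - lam * c * (knot T N k - knot T N j)| <= e * (knot T N k - knot T N j).
Proof.
move=> /andP[l0 l1] vS; elim: k => [|k IH] /andP[jk kN] ye.
  by move: jk; rewrite leqn0 => /eqP ->; rewrite !subrr !mulr0 subrr normr0.
move: jk; rewrite leq_eqVlt => /orP[/eqP->|]; first by rewrite !subrr !mulr0 subrr normr0.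
rewrite ltnS => jk.
have {}IH := IH _ _; rewrite vS// knotS; set h := T%:num / _.
have h0 : 0 <= h by rewrite divr_ge0.
clearbody h.
rewrite (_ : _ - _ = (v k - v j - lam * c * (knot T N k - knot T N j)) + lam * h * (y k - c)); last by ring.
apply: (le_trans (ler_normD _ _)).
rewrite (_ : e * _ = e * (knot T N k - knot T N j) + h * e); last by ring.
apply: lerD.
  by apply: IH => [|i /andP[ji ik]]; [rewrite jk ltnW|apply: ye; rewrite ji ltnW].
rewrite !normrM (ger0_norm l0) (ger0_norm h0) -mulrA mulrCA ler_wpM2l//.
have yk := ye k; rewrite jk ltnSn in yk.
by apply: le_trans (yk isT); apply: ler_piMl.
Qed.

Lemma convex_dist_le (a b q e th : R) : `|a - q| <= e -> `|b - q| <= e -> 0 <= th <= 1 ->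
  `|a + th * (b - a) - q| <= e.
Proof.
move=> aq bq /andP[t0 t1]; rewrite (_ : _ - q = (1 - th) * (a - q) + th * (b - q)); last by ring.
apply: (le_trans (ler_normD _ _)); rewrite !normrM (ger0_norm t0) ger0_norm ?subr_ge0//.
have -> : e = (1 - th) * e + th * e by ring.
by rewrite lerD// ler_wpM2l// subr_ge0.
Qed.

Lemma mesh_near (e : R) : 0 < e -> \forall N \near \oo, T%:num / N.+1%:R < e.
Proof.
move=> e0; have eT : 0 < e / T%:num by rewrite divr_gt0.
have := near_infty_natSinv_lt (PosNum eT); apply: filterS => N /=.
by rewrite ltr_pdivlMr// mulrC.
Qed.

Context (f : R * R * R -> R) (phi psi : R -> R).
Context (f_cont : {within strip T, continuous f}) (phi_cont : continuous phi)
  (psi_cont : continuous psi) (phiK : cancel phi psi) (psiK : cancel psi phi).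

Context (F : set_system nat) {UF : UltraFilter F}.
Context (F_oo : forall A : set nat, \oo A -> F A).
#[local] Instance proper_F : ProperFilter F := ultra_proper.

(** Bounded polygons have values [v] that are uniformly Lipschitz along the knots, so their slopes
    [psi v] are equicontinuous and Ascoli's argument applies. The discrete increments then pass to
    the limit. *)
Lemma polygon_limit (lam_ : nat -> R) (x_ : nat -> 'rV[R]_2) (B : R) :
  (forall N, 0 <= lam_ N <= 1) ->
  (\forall N \near F, `|polygon T f phi psi N (lam_ N) (x_ N)| <= B) ->
  exists (lam : R) (u : C1 T), [/\ lam_ N @[N --> F] --> lam,
    polygon T f phi psi N (lam_ N) (x_ N) @[N --> F] --> u,
    is_C1 (phi \o dseg u) & forall t, dseg (phi \o dseg u) t = lam * nemytskii f u t].
Proof.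
move=> lam01 uB; pose u_ N := polygon T f phi psi N (lam_ N) (x_ N).
have [lam lamE] : exists lam : R, lam_ N @[N --> F] --> lam.
  apply: (@ultra_bounded_cvg _ _ _ _ _ 1); apply: nearW => N.
  by have /andP[l0 l1] := lam01 N; rewrite ger0_norm.
have [v_ v_spec] := choice (fun N => @polygon_spec R T f phi psi phiK N (lam_ N) (x_ N)).
have vphi N k : (k <= N.+1)%N -> v_ N k = phi (dseg (u_ N) (projseg T (knot T N k))).
  by move=> kN; have [_ _ h _] := v_spec N; rewrite /u_ h// psiK.
have [C C0 fC] : exists2 C : R, 0 <= C & forall N, `|u_ N| <= B -> forall t, `|nemytskii f (u_ N) t| <= C.
  have [|C C0 hC] := @bounded_on_compact _
    ([set` `[0, T%:num]] `*` [set` `[- B, B]] `*` [set` `[- B, B]]) (fclamp T f) _ (fclamp_continuous f_cont).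
    by do 2 (apply: compact_setX; last exact: segment_compact); exact: segment_compact.
  exists C => // N uNB t; apply: hC; split; [split|]; rewrite /= in_itv/= ?segval_itv// -ler_norml.
    exact: le_trans (C1_norm_val _ _) uNB.
  exact: le_trans (C1_norm_dseg _ _) uNB.
have [V V0 phiV] : exists2 V : R, 0 <= V & forall y, `|y| <= B -> `|phi y| <= V.
  have [V V0 hV] := bounded_on_compact (@segment_compact R (- B) B) phi_cont.
  by exists V => // y yB; apply: hV; rewrite /= in_itv/= -ler_norml.
have vV N k : `|u_ N| <= B -> (k <= N.+1)%N -> `|v_ N k| <= V.
  by move=> uNB kN; rewrite vphi//; apply: phiV; exact: le_trans (C1_norm_dseg _ _) uNB.
have vL N j k : `|u_ N| <= B -> (j <= N.+1)%N -> (k <= N.+1)%N ->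
    `|v_ N k - v_ N j| <= C * `|knot T N k - knot T N j|.
  move=> uNB; wlog jk : j k / (j <= k)%N => [h jN kN|jN kN].
    have [jk|/ltnW kj] := leqP j k; first exact: h.
    by rewrite distrC [`|knot T N k - _|]distrC; exact: h.
  have [_ vS _ _] := v_spec N; have jkN : (j <= k <= N.+1)%N by rewrite jk.
  have := @discrete_increment N (lam_ N) (v_ N) (fun i => nemytskii f (u_ N) (projseg T (knot T N i)))
    0 C j k (lam01 N) vS jkN.
  have kj : 0 <= knot T N k - knot T N j by rewrite subr_ge0 knot_le.
  rewrite mulr0 mul0r subr0 (ger0_norm kj).
  by apply => i _; rewrite subr0 fC.
have equi : equicontinuous_along F (fun N => dseg (u_ N)).
  move=> e e0; have [eta eta0 etaP] := uniform_on_segment V psi_cont e0.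
  have C10 : 0 < C + 1 by lra.
  (* If [s] and [t] are within [d] and the mesh is below [d / 2], the ends of their cells are within
     [2 * d], so the values [v] there differ by at most [C * (2 * d) < eta]. The summand 1 covers
     [C = 0]. *)
  pose d := eta / 2 / (C + 1).
  have d0 : 0 < d by rewrite !divr_gt0.
  have dE : (C + 1) * d = eta / 2 by rewrite /d mulrC divfK// gt_eqF.
  clearbody d.
  exists d => //; have d20 : 0 < d / 2 by rewrite divr_gt0.
  have mesh := F_oo (mesh_near d20).
  apply: filterS2 uB mesh => N uNB mesh s t st.
  have [j jN /andP[sj1 sj2]] := knot_cell N s; have [k kN /andP[tk1 tk2]] := knot_cell N t.
  have [_ _ _ cell] := v_spec N.
  have [th1 th11 ->] := cell j s jN (introT andP (conj sj1 sj2)).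
  have [th2 th21 ->] := cell k t kN (introT andP (conj tk1 tk2)).
  (* The slopes at [s] and [t] are convex combinations of the slopes at the ends of their cells, so
     comparing the latter pairwise is enough. *)
  have close a b : (j <= a <= j.+1)%N -> (k <= b <= k.+1)%N -> `|psi (v_ N b) - psi (v_ N a)| <= e.
    move=> /andP[ja aj] /andP[kb bk].
    have aN : (a <= N.+1)%N by rewrite (leq_trans aj).
    have bN : (b <= N.+1)%N by rewrite (leq_trans bk).
    apply: etaP; first exact: (vV N b uNB bN).
    apply: le_lt_trans (vL N a b uNB aN bN) _.
    move: ja aj kb bk; rewrite -!(knot_le T N) => ja aj kb bk.
    move: sj2 tk2 aj bk mesh; rewrite !knotS /=; move: (T%:num / N.+1%:R) => h sj2 tk2 aj bk mesh.
    apply: (@le_lt_trans _ _ (C * (2 * d))).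
      rewrite ler_wpM2l//; move: st; rewrite ltr_norml => /andP[st1 st2].
      clear -sj1 sj2 tk1 tk2 ja aj kb bk mesh st1 st2.
      by rewrite ler_norml; apply/andP; split; lra.
    by rewrite (_ : C * (2 * d) = 2 * ((C + 1) * d) - 2 * d); [rewrite dE; lra|ring].
  apply: (convex_dist_le _ _ th11); rewrite distrC; apply: (convex_dist_le _ _ th21);
    by apply: close; rewrite ?leqnn ?leqnSn.
have [u uE] := C1_ultra_cvg uB equi.
have [_ cdu] := C1P u.
(* For each mesh, the index of a cell containing [t]; its left knot tends to [t], and [v] there
   tends to [phi (u' t)]. *)
pose cells (t : seg T) (k_ : nat -> nat) := forall N,
  (k_ N <= N)%N /\ knot T N (k_ N) <= segval t <= knot T N (k_ N).+1.
have cells_ex t : exists k_, cells t k_.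
  have h N : exists k, (k <= N)%N /\ knot T N k <= segval t <= knot T N k.+1.
    by have [k kN kt] := knot_cell N t; exists k.
  by have [k_ hk] := choice h; exists k_.
have knot_near t k_ (d : R) : cells t k_ -> 0 < d ->
    \forall N \near F, segval t - d < knot T N (k_ N) <= segval t.
  move=> kt d0; have := F_oo (mesh_near d0); apply: filterS => N /= mesh.
  have [_ /andP[-> +]] := kt N; rewrite knotS andbT.
  by move: (T%:num / N.+1%:R) mesh => h mesh; lra.
have knot_cvg t k_ : cells t k_ -> knot T N (k_ N) @[N --> F] --> segval t.
  move=> kt; apply/cvgrPdist_le => e e0; have := knot_near t k_ e kt e0.
  by apply: filterS => N /andP[h1 h2]; rewrite ger0_norm ?subr_ge0//; lra.
have v_cvg t k_ : cells t k_ -> v_ N (k_ N) @[N --> F] --> phi (dseg u t).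
  move=> kt; have vE N : v_ N (k_ N) = phi (dseg (u_ N) (projseg T (knot T N (k_ N)))).
    by rewrite vphi//; have [kN _] := kt N; exact: leqW.
  under eq_cvg do rewrite vE.
  suff h : dseg (u_ N) (projseg T (knot T N (k_ N))) @[N --> F] --> dseg u t.
    exact: (cvg_comp _ phi h (@phi_cont _)).
  apply/cvgrPdist_le => e e0; have e20 : 0 < e / 2 by rewrite divr_gt0.
  have uN : \forall N \near F, forall t, `|u_ N t - u t| <= e / 2 /\ `|dseg (u_ N) t - dseg u t| <= e / 2.
    exact: uE _ (C1_near u e20).
  have /continuous_segP/(_ t _ e20)[d d0 dP] := cdu.
  have := knot_near t k_ d kt d0; apply: filterS2 uN => N uN /andP[h1 h2].
  have [kN _] := kt N.
  have := dP (projseg T (knot T N (k_ N))); rewrite segval_knot; last exact: leqW.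
  rewrite ger0_norm ?subr_ge0// => /(_ _) h3.
  have {}h3 : `|dseg u t - dseg u (projseg T (knot T N (k_ N)))| < e / 2 by apply: h3; lra.
  have [_ h4] := uN (projseg T (knot T N (k_ N))); rewrite distrC in h4.
  apply: (le_trans (ler_distD (dseg u (projseg T (knot T N (k_ N)))) _ _)); lra.
have cnem : continuous (fun t => lam * nemytskii f u t).
  move=> t; apply: (cvgMl_tmp (FF := nbhs_filter t)).
  exact: (@nemytskii_continuous_seg R T f f_cont u t).
have [|c1 d1] := @is_C1_of_derivative R T (phi \o dseg u) _ cnem; last first.
  by exists lam, u; split => // t; rewrite d1.
move=> t e e0; have [d d0 dP] := nemytskii_continuous f_cont u t e0.
have {}dP : \forall N \near F, forall s, `|segval t - segval s| < d ->
    `|nemytskii f (u_ N) s - nemytskii f u t| <= e := uE _ dP.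
have d20 : 0 < d / 2 by rewrite divr_gt0.
(* The left knots of [s] and [t] are eventually less than [d / 2] away from them, so all knots in
   between stay within [d] of [t]. *)
exists (d / 2) => // s; rewrite ltr_norml => /andP[ts1 ts2].
have [k_ kt] := cells_ex t; have [j_ js] := cells_ex s.
(* The defect in the increment estimate between the two left knots: it is eventually nonpositive,
   and its limit is the defect in the derivative estimate for [phi u']. *)
pose D N := `|v_ N (j_ N) - v_ N (k_ N) -
  lam_ N * nemytskii f u t * (knot T N (j_ N) - knot T N (k_ N))| -
  e * `|knot T N (j_ N) - knot T N (k_ N)|.
have Dle : \forall N \near F, D N <= 0.
  have nk := knot_near t k_ _ kt d20; have nj := knot_near s j_ _ js d20.
  near=> N; have /andP[tk1 tk2] : segval t - d / 2 < knot T N (k_ N) <= segval t by near: N.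
  have /andP[sj1 sj2] : segval s - d / 2 < knot T N (j_ N) <= segval s by near: N.
  have dN : forall s, `|segval t - segval s| < d ->
    `|nemytskii f (u_ N) s - nemytskii f u t| <= e by near: N.
  have [_ vS _ _] := v_spec N; have [kN _] := kt N; have [jN _] := js N.
  rewrite /D subr_le0; have [jk|/ltnW kj] := leqP (j_ N) (k_ N).
    have jkN : (j_ N <= k_ N <= N.+1)%N by rewrite jk leqW.
    have := discrete_increment (lam01 N) vS jkN.
    rewrite distrC [X in _ -> _ <= e * X]distrC [`|knot T N (k_ N) - _|]ger0_norm ?subr_ge0 ?knot_le//.
    rewrite (_ : lam_ N * nemytskii f u t * _ - _ = v_ N (k_ N) - v_ N (j_ N) - 
      lam_ N * nemytskii f u t * (knot T N (k_ N) - knot T N (j_ N))); last by ring.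
    apply => i /andP[ji ik]; apply: dN; rewrite segval_knot; last by lia.
    move: ji (ltnW ik); rewrite -!(knot_le T N) => {}ji {}ik.
    clear -ji ik tk1 tk2 sj1 sj2 ts1 ts2 d0.
    by rewrite ltr_norml; apply/andP; split; lra.
  have kjN : (k_ N <= j_ N <= N.+1)%N by rewrite kj leqW.
  have := discrete_increment (lam01 N) vS kjN.
  rewrite [`|knot T N (j_ N) - _|]ger0_norm ?subr_ge0 ?knot_le//.
  apply => i /andP[ji ik]; apply: dN; rewrite segval_knot; last by lia.
  move: ji (ltnW ik); rewrite -!(knot_le T N) => {}ji {}ik.
  clear -ji ik tk1 tk2 sj1 sj2 ts1 ts2 d0.
  by rewrite ltr_norml; apply/andP; split; lra.
rewrite -subr_le0.
have Dcvg : D N @[N --> F] --> `|phi (dseg u s) - phi (dseg u t) -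
  lam * nemytskii f u t * (segval s - segval t)| - e * `|segval s - segval t|.
  have kd : knot T N (j_ N) - knot T N (k_ N) @[N --> F] --> segval s - segval t.
    by apply: cvgB; exact: knot_cvg.
  apply: cvgB; last by apply: cvgM; [exact: cvg_cst|exact: cvg_norm].
  apply: cvg_norm; apply: cvgB; first by apply: cvgB; exact: v_cvg.
  by apply: cvgM => //; apply: cvgM => //; exact: cvg_cst.
exact: (cvgr_to_le Dcvg Dle).
Unshelve. all: by end_near. Qed.

End limit.

(** * The continuation theorem *)

Lemma frontier_open {X : topologicalType} (O : set X) x :
  open O -> frontier O x <-> closure O x /\ ~ O x.
Proof. by move=> /interior_id oO; rewrite /frontier oO. Qed.

Section solutions.
Context {R : realType} (T : {posnum R}) (f : R * R * R -> R) (phi psi : R -> R).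
Context (f_cont : {within strip T, continuous f}) (phi_cont : continuous phi)
  (psi_cont : continuous psi) (phiK : cancel phi psi) (psiK : cancel psi phi).

Lemma Gseg_eq0 (u : C1 T) : Gseg f u = 0 -> u (segT T) = dseg u (seg0 T) /\
  \int[lebesgue_measure]_(x in `[0, T%:num]) nemytskii f u (projseg T x) = 0.
Proof.
move=> G0; have := congr1 (fun v : 'rV[R]_2 => v 0 0) G0.
have := congr1 (fun v : 'rV[R]_2 => v 0 1) G0; rewrite /Gseg vec0 vec1 !mxE.
move=> /eqP; rewrite subr_eq0 => /eqP e1; rewrite -e1 subrr mulr0 sub0r => /eqP.
have T0 : 0 < T%:num :> R by [].
by rewrite oppr_eq0 mulf_eq0 invr_eq0 (gt_eqF T0) => /eqP.
Qed.

Lemma is_solution_Gseg (lam : R) (u : C1 T) : is_C1 (phi \o dseg u) ->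
  (forall t, dseg (phi \o dseg u) t = lam * nemytskii f u t) -> Gseg f u = 0 ->
  is_solution phi (fun p => lam * f p) u.
Proof.
move=> c1 d1 /Gseg_eq0[e1 e2]; split => //.
  by move=> t; rewrite d1 /nemytskii fclampE// /strip/= segval_itv.
(* The condition [u'(0) = u'(T)] comes from the equation: the increment of [phi u'] over the segment
   is [lam] times an integral that vanishes. *)
apply: (can_inj phiK); apply/eqP; rewrite eq_sym -subr_eq0; apply/eqP.
have := integral_dseg c1; rewrite /= => <-.
rewrite (_ : (fun x => dseg _ _) = (fun x => lam * nemytskii f u (projseg T x))); last first.
  by apply/funext => x; rewrite d1.
rewrite RintegralZl ?e2 ?mulr0//.
apply: continuous_compact_integrable; first exact: segment_compact.
by apply: continuous_subspaceT; exact/continuous_projseg/nemytskii_continuous_seg.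
Qed.

(** [phi u'] is constant, hence so is [u']. This puts the limits with [lam = 0] into the plane of
    affine functions. *)
Lemma affine_of_dseg0 (u : C1 T) : is_C1 (phi \o dseg u) ->
  (forall t, dseg (phi \o dseg u) t = 0) ->
  u = affineC1 T (vec (u (seg0 T)) (dseg u (seg0 T))).
Proof.
move=> c1 d1; have w0 t : dseg u t = dseg u (seg0 T).
  apply: (can_inj phiK); apply/eqP; rewrite -subr_eq0 -normr_le0.
  have := @mean_value_le R T _ (seg0 T) t 0 0 c1; rewrite !mul0r !subr0; apply => r _.
  by rewrite subr0 d1 normr0.
apply: val_inj; apply/funext => t; rewrite /= vec0 vec1; apply/eqP.
have := @mean_value_le R T u (seg0 T) t (dseg u (seg0 T)) 0 (C1P u).
rewrite mul0r (_ : segval (seg0 T) = 0)// subr0 => /(_ _).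
rewrite normr_le0 -addrA -opprD subr_eq0; apply => r _.
by rewrite w0 subrr normr0.
Qed.

(** Otherwise every mesh has a bad polygon. Their limit along an ultrafilter is a zero of [Gseg]
    solving the equation for a limit [lam], and each value of [lam] in the unit interval contradicts
    one of the hypotheses. *)
Lemma polygon_admissible (Omega : set (C1 T)) :
  open Omega -> bounded_set Omega ->
  (forall lam : R, 0 < lam < 1 ->
      ~ exists u : C1 T, frontier Omega u /\
          is_solution phi (fun p => lam * f p) u) ->
  ~ (exists v : 'rV[R]_2, frontier Omega (affineC1 T v) /\ Gmap T f v = 0) ->
  ~ (exists u : C1 T, is_solution phi f u) ->
  exists N, forall lam x, 0 <= lam <= 1 -> Gseg f (polygon T f phi psi N lam x) = 0 ->
    ~ frontier Omega (polygon T f phi psi N lam x) /\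
    (lam = 1 -> ~ closure Omega (polygon T f phi psi N lam x)).
Proof.
move=> oO bO H1 H2 noSol; apply: contrapT => nogood.
have [B OB] : exists B : R, forall u, Omega u -> `|u| <= B.
  by have [B [_ hB]] := bO; exists (B + 1) => u; apply: hB; rewrite ltrDl.
have ex N : exists p : R * 'rV[R]_2,
    [/\ 0 <= p.1 <= 1, Gseg f (polygon T f phi psi N p.1 p.2) = 0,
     closure Omega (polygon T f phi psi N p.1 p.2) &
     frontier Omega (polygon T f phi psi N p.1 p.2) \/ p.1 = 1].
  apply: contrapT => nbad; apply: nogood; exists N => lam x lam01 G0.
  by split=> [fr|l1 cl]; apply: nbad; exists (lam, x); split => //; [case: fr|left|right].
have [px bad] := choice ex.
have [F [UF Foo]] := ultraFilterLemma eventually_filter.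
pose PF : ProperFilter F := ultra_proper.
pose u_ N := polygon T f phi psi N (px N).1 (px N).2.
have [||lam [u [lamE uE c1 d1]]] := @polygon_limit R T f phi psi f_cont phi_cont psi_cont phiK psiK
    F UF Foo (fun N => (px N).1) (fun N => (px N).2) (B + 1).
- by move=> N; have [] := bad N.
(* A point of the closure is within 1 of a point of [Omega], whence the bound [B + 1]. *)
- apply: nearW => N; have [_ _ cl _] := bad N.
  have [v [Ov]] := cl _ (nbhsx_ballx _ 1 ltr01); rewrite -ball_normE /ball_/= => uv.
  have := ler_normD (u_ N - v) v; rewrite subrK => h; apply: (le_trans h).
  by have := OB v Ov; lra.
have G0 : Gseg f u = 0.
  have h : Gseg f (u_ N) @[N --> F] --> Gseg f u.
    exact: (cvg_comp _ (@Gseg R T f) uE (@Gseg_continuous R T f f_cont u)).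
  have h0 : Gseg f (u_ N) @[N --> F] --> (0 : 'rV[R]_2).
    have GN N : Gseg f (u_ N) = 0 by have [] := bad N.
    by under eq_cvg do rewrite GN; exact: cvg_cst.
  exact: (cvg_unique _ h h0).
have lam01 : 0 <= lam <= 1.
  apply/andP; split.
    by apply: (cvgr_to_ge lamE); apply: nearW => N; have [/andP[]] := bad N.
  by apply: (cvgr_to_le lamE); apply: nearW => N; have [/andP[]] := bad N.
have sol := is_solution_Gseg c1 d1 G0.
have lam1 : lam <> 1.
  move=> l1; apply: noSol; exists u; move: sol; rewrite l1.
  by rewrite (_ : (fun p => 1 * f p) = f)//; apply/funext => p; rewrite mul1r.
(* The ultrafilter decides: either the polygons lie on the frontier along [F], or [lam] equals 1
   along [F], and then the limit would solve the original problem. *)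
have [fr|nfr] := in_ultra_setVsetC [set N | frontier Omega (u_ N)] UF; last first.
  have h : (px N).1 @[N --> F] --> (1 : R).
    apply: cvg_near_cst; apply: filterS nfr => N /= nfr.
    by have [_ _ _ []] := bad N.
  exact: (lam1 (cvg_unique _ lamE h)).
have fru : frontier Omega u.
  apply/(frontier_open u oO); split.
    apply: (closed_cvg _ (@closed_closure _ Omega) _ u uE).
    by apply: nearW => N; have [] := bad N.
  move=> Ou; have nO : nbhs u Omega by apply: open_nbhs_nbhs.
  have FO : F [set N | Omega (u_ N)] := uE _ nO.
  have /filter_ex[N [/(frontier_open _ oO)[_ nON] ON]] :
      F ([set N | frontier Omega (u_ N)] `&` [set N | Omega (u_ N)]).
    exact: filterI.
  exact: nON ON.
(* For [lam = 0] the limit is affine, hence a zero of G on the frontier; otherwise [lam] lies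
   strictly between 0 and 1. *)
have [l0|ln0] := eqVneq lam 0.
  apply: H2; exists (vec (u (seg0 T)) (dseg u (seg0 T))).
  rewrite -affine_of_dseg0//; last by move=> t; rewrite d1 l0 mul0r.
  split => //; rewrite -Gseg_affine -affine_of_dseg0//.
  by move=> t; rewrite d1 l0 mul0r.
apply: (H1 lam); last by exists u.
have /andP[l0 l1] := lam01; apply/andP; split; first by rewrite lt_def ln0.
by rewrite lt_def l1 andbT eq_sym; apply/eqP.
Qed.

End solutions.

Theorem theorem5p3 (R : realType) (T : {posnum R})
    (phi : R -> R) (f : R * R * R -> R) (Omega : set (C1 T))
    (phi_homeo : homeomorphism phi) (phi0 : phi 0 = 0)
    (f_cont : {within strip T, continuous f})
    (Omega_open : open Omega) (Omega_bounded : bounded_set Omega)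
    (H1 : forall lam : R, 0 < lam < 1 ->
      ~ exists u : C1 T, frontier Omega u /\
          is_solution phi (fun p => lam * f p) u)
    (H2 : ~ exists v : 'rV[R]_2,
          frontier Omega (affineC1 T v) /\ Gmap T f v = 0)
    (H3 : brouwer_degree (Gmap T f) (affineC1 T @^-1` Omega) 0 <> 0) :
  exists u : C1 T, is_solution phi f u.
Proof.
apply: contrapT => noSol.
have [psi [phi_cont psi_cont phiK psiK]] := phi_homeo.
set U := affineC1 T @^-1` Omega in H3.
(* [brouwer_degree] defaults to 0 when no integer meets its specification, so a nonzero value does
   meet it and comes with a smooth approximation [g]. *)
have [d [d0 [g [g_smooth [e eG gG] g_reg dE]]]] :
    exists d, d <> 0 /\ degree_spec (Gmap T f) U 0 d.
  by move: H3; rewrite /brouwer_degree; case: xgetP => // d _ dP d0; exists d.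
(* The mesh [N] is fixed from here on; the homotopy parameter is [lam]. *)
have [N adm] := polygon_admissible f_cont phi_cont psi_cont phiK psiK Omega_open Omega_bounded H1 H2 noSol.
pose u_ (p : R * 'rV[R]_2) := polygon T f phi psi N p.1 p.2.
have cu : continuous u_ := @polygon_continuous R T f phi psi f_cont phi_cont psi_cont N.
have [M OM] : exists M : nat, forall u, Omega u -> `|u| < M%:R.
  have [B [_ hB]] := Omega_bounded; exists (Num.bound `|B + 1|) => u Ou.
  apply: (le_lt_trans (hB (B + 1) _ u Ou)); first by rewrite ltrDl.
  exact: (le_lt_trans (ler_norm _) (archi_boundP (normr_ge0 _))).
(* The initial data are the value and the slope of the polygon at 0, both bounded by its norm. So
   the moving domain stays inside the box. *)
have xM p : Omega (u_ p) -> `|p.2| < M%:R.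
  move=> /OM uM; have [e1 e2] := @polygon_initial R T f phi psi N p.1 p.2.
  rewrite norm_rV2_lt -e1 -e2; apply/andP; split.
    exact: le_lt_trans (C1_norm_val _ _) uM.
  exact: le_lt_trans (C1_norm_dseg _ _) uM.
have affE x : affineC1 T x = u_ (0, x) by rewrite /u_ polygon0.
have GE x : Gmap T f x = Gseg f (u_ (0, x)) by rewrite -affE Gseg_affine.
have cpair (t : R) : continuous (fun x : 'rV[R]_2 => (t, x)).
  move=> x A [[B C] /= [tB xC] BCA]; apply: (@filterS _ (nbhs x) _ C) => // y Cy.
  by apply: BCA; split => //; exact: nbhs_singleton tB.
have caff : continuous (affineC1 T).
  rewrite (_ : affineC1 T = u_ \o (fun x => (0, x))); last by apply/funext => x; rewrite affE.
  by move=> x; apply: continuous_comp; [exact: cpair|exact: cu].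
have cG : continuous (Gmap T f).
  rewrite (_ : Gmap T f = Gseg f \o affineC1 T); last by apply/funext => x; rewrite /= Gseg_affine.
  by move=> x; apply: continuous_comp; [exact: caff|exact: Gseg_continuous].
have cg : continuous g := g_smooth 0%N.
have dg x : differentiable g x by have [] := g_smooth 1%N.
have oU : open U by apply: open_comp.
have UM x : U x -> `|x| < M%:R by rewrite /U /= affE; exact: xM.
(* On the frontier [|g - G| < e <= |G|], so [g] has no zero there. *)
have s1 : \forall n \near \oo, winding M n g (ind U) = regular_degree g U 0 * 3.
  apply: winding_regular => //; last by apply/eqP; rewrite -dE.
  move=> x fx; have := eG x fx; have := gG x fx.1; rewrite subr0 => h1 h2.
  by apply: contraTneq (lt_le_trans h1 h2) => ->; rewrite sub0r normrN ltxx.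
(* Straight-line homotopy over the fixed domain [U]: a zero on the frontier would give
   [|G| <= |g - G|]. *)
have s2 : \forall n \near \oo, winding M n g (ind U) = winding M n (Gmap T f) (ind U).
  have := @winding_homotopy R M (fun p : R * 'rV[R]_2 => (1 - p.1) *: g p.2 + p.1 *: Gmap T f p.2)
    (fun p => ind U p.2).
  have -> : (fun x : 'rV[R]_2 => (1 - ((0 : R), x).1) *: g ((0 : R), x).2 +
      ((0 : R), x).1 *: Gmap T f ((0 : R), x).2) = g.
    by apply/funext => x /=; rewrite subr0 !scale1r scale0r addr0.
  have -> : (fun x : 'rV[R]_2 => (1 - ((1 : R), x).1) *: g ((1 : R), x).2 +
      ((1 : R), x).1 *: Gmap T f ((1 : R), x).2) = Gmap T f.
    by apply/funext => x /=; rewrite subrr !scale1r scale0r add0r.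
  apply => [t x /andP[t0 t1] _|t x _ Mx]; last first.
    by apply: ind0 => /UM; rewrite ltNge Mx.
  have [fx|nfx] := pselect (frontier U x); last first.
    right; have lc := ind_near nfx.
    exact: (@cvg_snd _ _ (nbhs t) (nbhs x) _ _ lc).
  left; split.
    have := eG x fx; have := gG x fx.1; rewrite subr0 /= => h1 h2.
    apply: contraTneq (lt_le_trans h1 h2) => h0; rewrite -leNgt.
    move: (g x) (Gmap T f x) h0 => v w h0.
    have we : w = - ((1 - t) *: (v - w)).
      by rewrite -[LHS]subr0 -h0; apply/rowP => j; rewrite !mxE; ring.
    by rewrite {1}we normrN normrZ ler_piMl// ger0_norm; lra.
  have c1 : (p : R * 'rV[R]_2).1 @[p --> (t, x)] --> t by exact: cvg_fst.
  have c2 : (p : R * 'rV[R]_2).2 @[p --> (t, x)] --> x by exact: cvg_snd.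
  apply: cvgD; apply: cvgZ => //.
  - by apply: cvgB => //; exact: cvg_cst.
  - exact: (cvg_comp _ _ c2 (cg x)).
  - exact: (cvg_comp _ _ c2 (cG x)).
(* Homotopy in [lam] over the domain of initial data whose polygon lies in [Omega]. At [lam = 0] the
   polygons are affine and this domain is [U]; at a zero, the polygon is off the frontier, so the
   weight is locally constant. *)
have s3 : \forall n \near \oo, winding M n (Gmap T f) (ind U) =
    winding M n (fun x => Gseg f (u_ (1, x))) (fun x => ind Omega (u_ (1, x))).
  have := @winding_homotopy R M (fun p => Gseg f (u_ p)) (fun p => ind Omega (u_ p)).
  have -> : (fun x => Gseg f (u_ (0, x))) = Gmap T f by apply/funext => x; rewrite GE.
  have -> : (fun x => ind Omega (u_ (0, x))) = ind U.
    by apply/funext => x; rewrite -affE.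
  apply => [t x t01 _|t x _ Mx]; last by apply: ind0 => /xM; rewrite ltNge Mx.
  have [G0|G0] := eqVneq (Gseg f (u_ (t, x))) 0; last first.
    left; split => //.
    exact: (cvg_comp _ (@Gseg R T f) (cu (t, x)) (@Gseg_continuous R T f f_cont _)).
  right; have [nfr _] := adm t x t01 G0.
  exact: (cu (t, x) _ (ind_near nfr)).
(* At [lam = 1] the polygon of a zero lies outside the closure of [Omega], so the weight vanishes
   near every zero. *)
have s4 : \forall n \near \oo,
    winding M n (fun x => Gseg f (u_ (1, x))) (fun x => ind Omega (u_ (1, x))) = 0.
  have cu1 (x : 'rV[R]_2) : u_ (1, y) @[y --> x] --> u_ (1, x).
    exact: (cvg_comp _ u_ (cpair 1 x) (cu (1, x))).
  apply: winding_vanish => x _.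
  have [G0|G0] := eqVneq (Gseg f (u_ (1, x))) 0; last first.
    left; split => //.
    exact: (cvg_comp _ (@Gseg R T f) (cu1 x) (@Gseg_continuous R T f f_cont _)).
  have le01 : 0 <= (1 : R) <= 1 by rewrite ler01 lexx.
  right; have [_ /(_ erefl) ncl] := adm 1 x le01 G0.
  have nO : \forall u \near u_ (1, x), ind Omega u = 0.
    have : nbhs (u_ (1, x)) (~` closure Omega).
      by apply: open_nbhs_nbhs; split => //; apply: closed_openC; exact: closed_closure.
    by apply: filterS => u ncu; apply: ind0 => /subset_closure.
  exact: (cu1 x _ nO).
have : \forall n \near \oo, d * 3 = 0.
  by near=> n; rewrite dE -(near s1 n)// (near s2 n)// (near s3 n)// (near s4 n).
move=> /filter_ex[_ /eqP]; rewrite mulf_eq0 orbF => /eqP; exact: d0.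
Unshelve. all: by end_near. Qed.
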